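(* For $t\in(0,\infty)$, let $S_t=\{(z,w)\in\mathbb{C}^2: w=p_t(z,\overline{z})\}$, where $p_t(z,\overline{z})=z^2\overline{z}+tz\overline{z}^2+\frac{t^2}{3}\overline{z}^3$. Then: (i) the surface $S_t$ is locally polynomially convex at the origin if $t>\dfrac{\sqrt{15-\sqrt{33}}}{2\sqrt{2}}$; (ii) $S_1$ is locally polynomially convex at the origin.
   Context: For a compact set $K\subset\mathbb{C}^n$, the polynomially convex hull is $\widehat{K}=\{z\in\mathbb{C}^n: |p(z)|\le\sup_K|p| \text{ for all } p\in\mathbb{C}[z_1,\dots,z_n]\}$; $K$ is polynomially convex if $\widehat{K}=K$. A closed set $E\subset\mathbb{C}^n$ is locally polynomially convex at $p\in E$ if $E\cap\overline{B(p;r)}$ is polynomially convex for some $r>0$, where $B(p;r)$ is the open ball in $\mathbb{C}^n$ with centre $p$ and radius $r$. *)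

(* Defs.v *)
From HB Require Import structures.
From mathcomp Require Import all_boot all_order all_algebra.
From mathcomp Require Import all_classical all_reals all_analysis.
From mathcomp Require Import complex.
(* mpoly is not imported: its notations clash with those of mathcomp-analysis. *)
From mathcomp Require mpoly.

Set Implicit Arguments.
Unset Strict Implicit.
Unset Printing Implicit Defensive.

Import Order.TTheory GRing.Theory Num.Theory.
Import numFieldNormedType.Exports.

Local Open Scope classical_set_scope.
Local Open Scope ring_scope.

(* The topology of C is inferred from the numClosedFieldType structure; it is
   not declared on the bare carrier R[i]. *)
Definition Cplx (R : realType) : numClosedFieldType := R[i].

Definition cmod (R : realType) (z : Cplx R) : R := ComplexField.Normc.normc z.

Definition rtoc (R : realType) (x : R) : Cplx R := (x%:C)%C.

(* The Euclidean norm on C^n: the library norm on row vectors is the sup norm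
   (the induced topology is the same). *)
Definition enorm (R : realType) (n : nat) (v : 'rV[Cplx R]_n) : R :=
  Num.sqrt (\sum_(i < n) cmod (v ord0 i) ^+ 2).

Definition oball (R : realType) (n : nat) (p : 'rV[Cplx R]_n) (r : R) :
    set 'rV[Cplx R]_n :=
  [set z | enorm (z - p) < r].

Definition peval (R : realType) (n : nat) (p : mpoly.mpoly n (Cplx R))
    (z : 'rV[Cplx R]_n) : Cplx R :=
  mpoly.meval (fun i => z ord0 i) p.

(* The supremum is taken in the extended reals, so the formula makes sense for
   every set K; it is meant for compact K, where the supremum is finite (and
   -oo for K empty, whose hull is empty). *)
Definition poly_hull (R : realType) (n : nat) (K : set 'rV[Cplx R]_n) :
    set 'rV[Cplx R]_n :=
  [set z | forall p : mpoly.mpoly n (Cplx R),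
     ((cmod (peval p z))%:E <=
      ereal_sup [set (cmod (peval p x))%:E | x in K])%E].

Definition poly_convex (R : realType) (n : nat) (K : set 'rV[Cplx R]_n) : Prop :=
  poly_hull K = K.

(* Meant for E closed and p in E, so that the intersection is compact. *)
Definition locally_poly_convex (R : realType) (n : nat)
    (E : set 'rV[Cplx R]_n) (p : 'rV[Cplx R]_n) : Prop :=
  exists2 r : R, 0 < r & poly_convex (E `&` closure (oball p r)).

Definition cubic (R : realType) (t : R) (z zbar : Cplx R) : Cplx R :=
  z ^+ 2 * zbar + rtoc t * z * zbar ^+ 2 + rtoc (t ^+ 2 / 3) * zbar ^+ 3.

Definition surf (R : realType) (t : R) : set 'rV[Cplx R]_2 :=
  [set v | let z := v ord0 ord0 in let w := v ord0 ord_max in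
           w = cubic t z (Num.conj z)].

(* Main.v *)
(** On [S_t] one has [3 t w + z^3 = (z + t z^* )^3], where [z^*] is the conjugate
of [z].

For [t = 1] the polynomial [3 w + z^3] is therefore the real number [(2 Re z)^3]
on the surface, and since it determines [Re z] there, comparing [Re z] with
quadratic polynomials in it shows that hull points satisfy the same equation.

For other [t], pulling back by [3 t w + z^3 = y^3] turns the surface into the
three planes [y = e (z + t z^* )], [e^3 = 1], which are totally real. They are
separated by Kallin's lemma with the quadratic polynomial
[q = (1 - t^2) z^2 + B z y + y^2], which maps the plane [e = 1] and the two
others into disjoint cones. With [B = 1] the planes [e <> 1] are mapped into
lines of slope [1 / sqrt 3] and [- 1 / sqrt 3], and the condition on the plane
[e = 1] is exactly [4 t^4 - 15 t^2 + 12 < 0], whose smaller root in [t^2] is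
[(15 - sqrt 33) / 8]; for [t^2 >= 5/2] one takes [B = 2 (t^2 - 1)], for which
[q >= 0] on the plane [e = 1].

The case of Kallin's lemma that is needed is elementary: if [f] maps [K] into
two disjoint cones, products of two square roots of multiples of [f] with
different cuts are uniform limits of polynomials on the hull, and such a product
is [f] on one part of [K] and [- f] on the other. *)

Require Import Defs.
From mathcomp Require Import all_boot all_order all_algebra.
From mathcomp Require Import all_classical all_reals all_analysis.
From mathcomp Require Import complex ring lra.
From mathcomp Require mpoly.
Import (canonicals, coercions) mpoly.
Import Order.TTheory GRing.Theory Num.Theory.
Import numFieldNormedType.Exports.
Local Open Scope ring_scope.

Set Implicit Arguments.
Unset Strict Implicit.
Unset Printing Implicit Defensive.

(** * Complex numbers *)

Section ComplexNumbers.
Variable R : realType.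
Implicit Types (x y z : Cplx R) (a : R).

Lemma cplx_ext x y :
  complex.Re x = complex.Re y -> complex.Im x = complex.Im y -> x = y.
Proof. by case: x y => [a b] [c d] /= -> ->. Qed.

Lemma Re_add x y : complex.Re (x + y) = complex.Re x + complex.Re y.
Proof. by case: x y => [a b] [c d]. Qed.

Lemma Im_add x y : complex.Im (x + y) = complex.Im x + complex.Im y.
Proof. by case: x y => [a b] [c d]. Qed.

Lemma Re_opp x : complex.Re (- x) = - complex.Re x.
Proof. by case: x. Qed.

Lemma Im_opp x : complex.Im (- x) = - complex.Im x.
Proof. by case: x. Qed.

Lemma Re_mul x y : complex.Re (x * y) =
  complex.Re x * complex.Re y - complex.Im x * complex.Im y.
Proof. by case: x y => [a b] [c d]. Qed.

Lemma Im_mul x y : complex.Im (x * y) =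
  complex.Re x * complex.Im y + complex.Im x * complex.Re y.
Proof. by case: x y => [a b] [c d]. Qed.

Lemma Re_0 : complex.Re (0 : Cplx R) = 0. Proof. by []. Qed.
Lemma Im_0 : complex.Im (0 : Cplx R) = 0. Proof. by []. Qed.
Lemma Re_1 : complex.Re (1 : Cplx R) = 1. Proof. by []. Qed.
Lemma Im_1 : complex.Im (1 : Cplx R) = 0. Proof. by []. Qed.
Lemma Re_rtoc a : complex.Re (rtoc a) = a. Proof. by []. Qed.
Lemma Im_rtoc a : complex.Im (rtoc a) = 0. Proof. by []. Qed.

Lemma Re_cconj z : complex.Re (Num.conj z) = complex.Re z.
Proof. by case: z. Qed.

Lemma Im_cconj z : complex.Im (Num.conj z) = - complex.Im z.
Proof. by case: z. Qed.

Definition ReImE := (Re_add, Im_add, Re_opp, Im_opp, Re_mul, Im_mul, Re_0, Im_0, Re_1, Im_1,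
  Re_rtoc, Im_rtoc, Re_cconj, Im_cconj).

Lemma cmod_sqr z : cmod z ^+ 2 = complex.Re z ^+ 2 + complex.Im z ^+ 2.
Proof. by case: z => a b; rewrite sqr_sqrtr // addr_ge0 ?sqr_ge0. Qed.

Lemma cmod_ge0 z : 0 <= cmod z.
Proof. by case: z => a b; exact: sqrtr_ge0. Qed.

Lemma cmodM x y : cmod (x * y) = cmod x * cmod y.
Proof. exact: ComplexField.Normc.normcM. Qed.

Lemma cmodD x y : cmod (x + y) <= cmod x + cmod y.
Proof. exact: le_normcD. Qed.

Lemma cmodN x : cmod (- x) = cmod x.
Proof. exact: normcN. Qed.

Lemma cmod0 : cmod (0 : Cplx R) = 0.
Proof. exact: ComplexField.Normc.normc0. Qed.

Lemma cmod1 : cmod (1 : Cplx R) = 1.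
Proof. exact: ComplexField.Normc.normc1. Qed.

Lemma cmodV x : cmod x^-1 = (cmod x)^-1.
Proof. exact: ComplexField.Normc.normcV. Qed.

Lemma cmodX x n : cmod (x ^+ n) = cmod x ^+ n.
Proof.
by elim: n => [|n IH]; rewrite ?expr0 ?cmod1 // !exprS cmodM IH.
Qed.

Lemma cmodB x y : cmod (x - y) = cmod (y - x).
Proof. by rewrite -cmodN opprB. Qed.

Lemma cmod_rtoc a : cmod (rtoc a) = `|a|.
Proof.
by rewrite /cmod /rtoc /= expr0n addr0 sqrtr_sqr.
Qed.

Lemma cmod_eq0 z : (cmod z == 0) = (z == 0).
Proof.
apply/eqP/eqP => [|->]; last exact: cmod0.
exact: ComplexField.Normc.eq0_normc.
Qed.

Lemma cmod_gt0 z : (0 < cmod z) = (z != 0).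
Proof. by rewrite lt_def cmod_eq0 cmod_ge0 andbT. Qed.

Lemma Re_le_cmod z : `|complex.Re z| <= cmod z.
Proof.
rewrite -(@ler_pXn2r _ 2) ?nnegrE ?cmod_ge0 ?normr_ge0 //.
by rewrite cmod_sqr real_normK ?num_real // lerDl sqr_ge0.
Qed.

Lemma Im_le_cmod z : `|complex.Im z| <= cmod z.
Proof.
rewrite -(@ler_pXn2r _ 2) ?nnegrE ?cmod_ge0 ?normr_ge0 //.
by rewrite cmod_sqr real_normK ?num_real // lerDr sqr_ge0.
Qed.

Lemma sqr_sqrt z : (sqrtc z : Cplx R) ^+ 2 = z.
Proof. exact: sqr_sqrtc. Qed.

Lemma Re_sqrt_ge0 z : 0 <= complex.Re (sqrtc z).
Proof. by case: z => a b; exact: sqrtr_ge0. Qed.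

Lemma sqrt_unique z w : w ^+ 2 = z -> 0 < complex.Re w -> w = sqrtc z.
Proof.
move=> wz w0; have /eqP := sqr_sqrt z.
rewrite -{2}wz eqf_sqr => /orP[/eqP //|/eqP sw].
have := Re_sqrt_ge0 z; by rewrite sw Re_opp oppr_ge0 leNgt w0.
Qed.

Lemma rtocM a b : rtoc (a * b) = rtoc a * rtoc b.
Proof. by apply: cplx_ext; rewrite !ReImE; lra. Qed.

Lemma cmod_mul_conj z : z * Num.conj z = rtoc (cmod z ^+ 2).
Proof. by apply: cplx_ext; rewrite !ReImE ?cmod_sqr; lra. Qed.

Lemma cmod_le_sqr z a : 0 <= a ->
  complex.Re z ^+ 2 + complex.Im z ^+ 2 <= a ^+ 2 -> cmod z <= a.
Proof.
by move=> a0; rewrite -cmod_sqr ler_pXn2r ?nnegrE ?cmod_ge0.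
Qed.

Lemma cmod_ge_sqr z a : 0 <= a ->
  a ^+ 2 <= complex.Re z ^+ 2 + complex.Im z ^+ 2 -> a <= cmod z.
Proof.
by move=> a0; rewrite -cmod_sqr ler_pXn2r ?nnegrE ?cmod_ge0.
Qed.

End ComplexNumbers.

(** * Uniform limits of polynomials on a hull *)

Lemma exprn_small (R : realType) (r e : R) : 0 <= r -> r < 1 -> 0 < e ->
  exists n : nat, r ^+ n < e.
Proof.
move=> r0 r1 e0.
have /cvg_expr/cvgrPdist_lt/(_ e e0) [n _ /(_ n (leqnn n))] : `|r| < 1.
  by rewrite ger0_norm.
by rewrite /= sub0r normrN ger0_norm ?exprn_ge0 // => ?; exists n.
Qed.

Section UniformAlgebra.
Variables (R : realType) (T : Type).
Local Notation C := (Cplx R).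

Record func_alg (P : (T -> C) -> Prop) : Prop := FuncAlg {
  alg_cst : forall c, P (fun=> c);
  alg_add : forall f g, P f -> P g -> P (fun x => f x + g x);
  alg_mul : forall f g, P f -> P g -> P (fun x => f x * g x) }.

(** Bounds [c] replace the supremum. For [K] empty a negative [c] is allowed, which empties the hull
    as soon as [P] has a member. *)
Definition hull (P : (T -> C) -> Prop) (K : set T) : set T :=
  [set q | forall f c, P f -> (forall x, K x -> cmod (f x) <= c) ->
                       cmod (f q) <= c].

Definition bounded_on (P : (T -> C) -> Prop) (K : set T) :=
  forall f, P f -> exists M, forall x, K x -> cmod (f x) <= M.

Definition uclosure (P : (T -> C) -> Prop) (Y : set T) (f : T -> C) :=
  forall e, 0 < e -> exists2 g, P g & forall y, Y y -> cmod (g y - f y) <= e.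

Lemma hullS P (K L : set T) : (forall x, K x -> L x) ->
  forall x, hull P K x -> hull P L x.
Proof. by move=> KL x xK f c Pf fc; apply: xK Pf _ => y /KL; exact: fc. Qed.

Lemma bounded_onS P (K L : set T) : (forall x, K x -> L x) ->
  bounded_on P L -> bounded_on P K.
Proof. by move=> KL bL f /bL[M fM]; exists M => x /KL; exact: fM. Qed.

Variables (P : (T -> C) -> Prop) (K : set T).
Hypotheses (PA : func_alg P) (bK : bounded_on P K).

Let Y := hull P K.
Let A := uclosure P Y.

Lemma alg_opp f : P f -> P (fun x => - f x).
Proof.
move=> Pf; have -> : (fun x => - f x) = (fun x => -1 * f x).
  by apply/funext => x; rewrite mulN1r.
exact (alg_mul PA (alg_cst PA (-1)) Pf).
Qed.

Lemma alg_sub f g : P f -> P g -> P (fun x => f x - g x).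
Proof. by move=> Pf Pg; apply: (alg_add PA Pf); exact: alg_opp. Qed.

Lemma alg_exp f n : P f -> P (fun x => f x ^+ n).
Proof.
move=> Pf; elim: n => [|n IH]; first exact: alg_cst PA _.
have -> : (fun x => f x ^+ n.+1) = (fun x => f x * f x ^+ n).
  by apply/funext => x; rewrite exprS.
exact (alg_mul PA Pf IH).
Qed.

(* Comparing [cmod (f + m)] with [m] as [m] tends to infinity turns the
   maximum principle for moduli into one for real parts. *)
Lemma hull_Re f c q : P f -> Y q -> (forall x, K x -> complex.Re (f x) <= c) ->
  complex.Re (f q) <= c.
Proof.
move=> Pf Yq fc; rewrite leNgt; apply/negP => cq.
have [M fM] := bK (alg_sub Pf (alg_cst PA (rtoc c))).
pose d := complex.Re (f q) - c.
have d0 : 0 < d by rewrite subr_gt0.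
(* On [K] the squared modulus is at most [m^2 + M^2]; at [q] it is at least [(d + m)^2], whose cross
   term [2 m d] exceeds [M^2]. *)
pose m := (M ^+ 2 + 1) / d.
have m0 : 0 < m by rewrite divr_gt0 // ltr_wpDl ?sqr_ge0.
pose s := Num.sqrt (m ^+ 2 + M ^+ 2).
have s2 : s ^+ 2 = m ^+ 2 + M ^+ 2 by rewrite sqr_sqrtr // addr_ge0 ?sqr_ge0.
have Pg : P (fun x => f x + rtoc (m - c)) by apply: (alg_add PA Pf); exact: alg_cst PA _.
have : cmod (f q + rtoc (m - c)) <= s.
  apply: (Yq _ _ Pg) => x Kx; apply: cmod_le_sqr; first exact: sqrtr_ge0.
  have := fM x Kx; have := fc x Kx; have := cmod_sqr (f x - rtoc c).
  have := cmod_ge0 (f x - rtoc c).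
  rewrite s2 !ReImE; set u := cmod _; move=> h1 h2 h3 h4.
  have : u ^+ 2 <= M ^+ 2 by rewrite ler_pXn2r ?nnegrE ?(le_trans h1).
  by rewrite h2; nra.
rewrite -(@ler_pXn2r _ 2) ?nnegrE ?cmod_ge0 ?sqrtr_ge0 // cmod_sqr s2 !ReImE.
have md : m * d = M ^+ 2 + 1 by rewrite divfK ?gt_eqF.
have -> : complex.Re (f q) + (m - c) = d + m by rewrite /d; ring.
have := sqr_ge0 (complex.Im (f q) + 0); have := sqr_ge0 d.
nra.
Qed.

(* If [a], [b] are the values of [f], [g] at [q], then on [K] the real part of
   [2 (a^* f + b^* g) - 2 f g] is at most [|a|^2 + |b|^2]. *)
Lemma hull_conj f g q : P f -> P g -> Y q ->
  (forall x, K x -> g x = Num.conj (f x)) -> g q = Num.conj (f q).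
Proof.
move=> Pf Pg Yq gf; set a := f q; set b := g q.
pose two : C := rtoc 2.
pose G x := two * (Num.conj a * f x + Num.conj b * g x) - two * (f x * g x).
have PG : P G.
  apply: alg_sub; apply: (alg_mul PA); try exact: alg_cst PA _.
    by apply: (alg_add PA); apply: (alg_mul PA) => //; exact: alg_cst PA _.
  exact (alg_mul PA Pf Pg).
have : forall x, K x -> complex.Re (G x) <= cmod a ^+ 2 + cmod b ^+ 2.
  move=> x Kx; rewrite /G (gf _ Kx) !cmod_sqr !ReImE.
  move: (complex.Re a) (complex.Im a) (complex.Re b) (complex.Im b) => c d c' d'.
  move: (complex.Re (f x)) (complex.Im (f x)) => r s.
  have := sqr_ge0 (c - r); have := sqr_ge0 (d - s).
  have := sqr_ge0 (c' - r); have := sqr_ge0 (d' + s).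
  rewrite !expr2; lra.
move=> /(hull_Re PG Yq); rewrite /G -/a -/b !cmod_sqr !ReImE.
move: (cplx_ext (x := b) (y := Num.conj a)); rewrite !ReImE.
move: (complex.Re a) (complex.Im a) (complex.Re b) (complex.Im b) => c d c' d' + h.
have h1 : (c' - c) ^+ 2 + (d' + d) ^+ 2 <= 0 by rewrite !expr2 in h *; lra.
have e1 : c' = c.
  apply/eqP; rewrite -subr_eq0 -sqrf_eq0 eq_le sqr_ge0 andbT.
  by apply: le_trans h1; rewrite lerDl sqr_ge0.
have e2 : d' = - d.
  apply/eqP; rewrite -addr_eq0 -sqrf_eq0 eq_le sqr_ge0 andbT.
  by apply: le_trans h1; rewrite lerDr sqr_ge0.
by apply.
Qed.

Lemma uclosure_P f : P f -> A f.
Proof.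
by move=> Pf e e0; exists f => // y _; rewrite subrr cmod0 ltW.
Qed.

Lemma uclosure_cst c : A (fun=> c).
Proof. exact: uclosure_P (alg_cst PA c). Qed.

Lemma uclosure_eq f g : (forall y, Y y -> f y = g y) -> A f -> A g.
Proof.
by move=> fg Af e /Af[h Ph hf]; exists h => // y Yy; rewrite -fg // hf.
Qed.

Lemma uclosure_lim f :
  (forall e, 0 < e -> exists2 g, A g & forall y, Y y -> cmod (g y - f y) <= e) ->
  A f.
Proof.
move=> Af e e0; have e2 : 0 < e / 2 by rewrite divr_gt0.
have [g Ag gf] := Af _ e2; have [h Ph hg] := Ag _ e2.
exists h => // y Yy.
have -> : h y - f y = (h y - g y) + (g y - f y) by ring.
by rewrite (le_trans (cmodD _ _)) // [e]splitr lerD ?hg ?gf.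
Qed.

Lemma hull_bounded f : A f -> exists2 M, 0 < M & forall y, Y y -> cmod (f y) <= M.
Proof.
move=> /(_ 1 ltr01)[g Pg gf]; have [M gM] := bK Pg.
exists (`|M| + 1) => [|y Yy]; first by rewrite ltr_wpDl.
have -> : f y = g y + - (g y - f y) by ring.
rewrite (le_trans (cmodD _ _)) // cmodN lerD ?gf //.
by apply: (le_trans _ (ler_norm M)); apply: Yy.
Qed.

Lemma subset_hull x : K x -> Y x.
Proof. by move=> Kx f c _; exact. Qed.

Lemma uclosure_hull f c : A f -> (forall x, K x -> cmod (f x) <= c) ->
  forall y, Y y -> cmod (f y) <= c.
Proof.
move=> Af fc y Yy; apply/ler_addgt0Pr => e e0.
have e2 : 0 < e / 2 by rewrite divr_gt0.
have [g Pg gf] := Af _ e2.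
have gy : cmod (g y) <= c + e / 2.
  apply: Yy => // x Kx; have -> : g x = f x + (g x - f x) by ring.
  by rewrite (le_trans (cmodD _ _)) // lerD ?fc ?gf //; exact: subset_hull.
have -> : f y = g y + - (g y - f y) by ring.
rewrite (le_trans (cmodD _ _)) // cmodN.
have := gf _ Yy; lra.
Qed.

Lemma uclosure_add f g : A f -> A g -> A (fun x => f x + g x).
Proof.
move=> Af Ag e e0; have e2 : 0 < e / 2 by rewrite divr_gt0.
have [f' Pf ff] := Af _ e2; have [g' Pg gg] := Ag _ e2.
exists (fun x => f' x + g' x) => [|y Yy]; first exact (alg_add PA Pf Pg).
have -> : f' y + g' y - (f y + g y) = (f' y - f y) + (g' y - g y) by ring.
by rewrite (le_trans (cmodD _ _)) // [e]splitr lerD ?ff ?gg.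
Qed.

Lemma uclosure_mul f g : A f -> A g -> A (fun x => f x * g x).
Proof.
move=> Af Ag e e0.
have [M M0 fM] := hull_bounded Af; have [N N0 gN] := hull_bounded Ag.
have e1 : 0 < Num.min 1 (e / (2 * N)).
  by rewrite lt_min ltr01 divr_gt0 ?mulr_gt0.
have [f' Pf ff] := Af _ e1.
have e2 : 0 < e / (2 * (M + 1)) by rewrite divr_gt0 ?mulr_gt0 ?addr_gt0.
have [g' Pg gg] := Ag _ e2.
exists (fun x => f' x * g' x) => [|y Yy]; first exact (alg_mul PA Pf Pg).
have -> : f' y * g' y - f y * g y = f' y * (g' y - g y) + (f' y - f y) * g y.
  by ring.
rewrite (le_trans (cmodD _ _)) // !cmodM [e]splitr lerD //.
  have -> : e / 2 = (M + 1) * (e / (2 * (M + 1))).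
    by field; rewrite gt_eqF ?addr_gt0.
  rewrite ler_pM ?cmod_ge0 ?gg //.
  have -> : f' y = f y + (f' y - f y) by ring.
  rewrite (le_trans (cmodD _ _)) // lerD ?fM //.
  by apply: le_trans (ff _ Yy) _; rewrite ge_min lexx.
have -> : e / 2 = e / (2 * N) * N by field; rewrite gt_eqF.
rewrite ler_pM ?cmod_ge0 ?gN //.
by apply: le_trans (ff _ Yy) _; rewrite ge_min lexx orbT.
Qed.

Lemma uclosure_opp f : A f -> A (fun x => - f x).
Proof.
move=> Af; apply: uclosure_eq (uclosure_mul (uclosure_cst (-1)) Af) => y _.
by rewrite mulN1r.
Qed.

Lemma uclosure_sub f g : A f -> A g -> A (fun x => f x - g x).
Proof. by move=> Af Ag; apply: uclosure_add => //; exact: uclosure_opp. Qed.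

Lemma uclosure_exp f n : A f -> A (fun x => f x ^+ n).
Proof.
move=> Af; elim: n => [|n IH]; first exact: uclosure_cst.
by apply: uclosure_eq (uclosure_mul Af IH) => y _; rewrite exprS.
Qed.

(** The iterates of [Phi] converge geometrically to [F] on the hull. Contraction is asked for only
    within [M] of [F], as the iteration for square roots contracts only near its limit. *)
Lemma uclosure_contraction (F g0 : T -> C) (Phi : (T -> C) -> T -> C) (M : R) :
  A g0 -> (forall g, A g -> A (Phi g)) ->
  (forall y, Y y -> cmod (g0 y - F y) <= M) ->
  (forall g y, Y y -> cmod (g y - F y) <= M ->
     cmod (Phi g y - F y) <= 3 / 4 * cmod (g y - F y)) ->
  A F.
Proof.
move=> A0 APhi F0 FPhi; apply: uclosure_lim => e e0.
have [M0|M0] := leP M 0.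
  by exists g0 => // y Yy; rewrite (le_trans (F0 _ Yy)) // (le_trans M0) // ltW.
have [n ne] : exists n : nat, (3 / 4 : R) ^+ n < e / M.
  by apply: exprn_small; rewrite ?divr_gt0 //; lra.
exists (iter n Phi g0).
  by elim: (n) => //= k IH; exact: APhi.
move=> y Yy; have : cmod (iter n Phi g0 y - F y) <= (3 / 4) ^+ n * M.
  elim: (n) => /= [|k IH]; first by rewrite expr0 mul1r F0.
  have M34 : (3 / 4 : R) ^+ k * M <= M.
    by rewrite ler_piMl ?(ltW M0) // exprn_ile1; lra.
  apply: le_trans (FPhi _ _ Yy (le_trans IH M34)) _.
  by rewrite exprS; lra.
move/le_trans; apply.
by rewrite -ler_pdivlMr // ltW.
Qed.

Lemma cmod_near1 (w : C) : cmod (1 - w) <= 1 / 2 -> 1 / 2 <= cmod w.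
Proof.
move=> w1; have := cmodD (1 - w) w; rewrite subrK cmod1; lra.
Qed.

(** Neumann series: the inverse is the fixed point of [g = 1 + (1 - f) g]. *)
Lemma uclosure_inv_near1 f : A f -> (forall y, Y y -> cmod (1 - f y) <= 1 / 2) ->
  A (fun x => (f x)^-1).
Proof.
move=> Af f1.
pose Phi (g : T -> C) x := 1 + (1 - f x) * g x.
have f0 y : Y y -> f y != 0.
  by move=> /f1/cmod_near1 h; rewrite -cmod_gt0; lra.
apply: (@uclosure_contraction _ (fun=> 1) Phi 1).
- exact: uclosure_cst.
- move=> g Ag; apply: uclosure_add; first exact: uclosure_cst.
  by apply: uclosure_mul => //; apply: uclosure_sub => //; exact: uclosure_cst.
- move=> y Yy; have -> : 1 - (f y)^-1 = - (1 - f y) / f y.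
    by field; exact: f0.
  rewrite cmodM cmodN cmodV ler_pdivrMr ?cmod_gt0 ?f0 // mul1r.
  by rewrite (le_trans (f1 _ Yy)) // cmod_near1 // f1.
- move=> g y Yy _; rewrite /Phi.
  have -> : 1 + (1 - f y) * g y - (f y)^-1 = (1 - f y) * (g y - (f y)^-1).
    by field; exact: f0.
  rewrite cmodM ler_wpM2r ?cmod_ge0 // (le_trans (f1 _ Yy)) //; lra.
Qed.

(** Each iteration adds half the residual [f - g^2]. With [s] the root, the error is multiplied by
    [(1 - s) + (s - g) / 2], of modulus at most [1/2 + 1/4]. *)
Lemma uclosure_sqrt_near1 f : A f -> (forall y, Y y -> cmod (1 - f y) <= 1 / 2) ->
  A (fun x => sqrtc (f x)).
Proof.
move=> Af f1.
pose Phi (g : T -> C) x := g x + rtoc (1 / 2) * (f x - g x * g x).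
have s1 y : Y y -> cmod (1 - sqrtc (f y)) <= 1 / 2.
  move=> Yy; set s : C := sqrtc (f y).
  have : cmod (1 - f y) = cmod (1 - s) * cmod (1 + s).
    by rewrite -cmodM -{1}(sqr_sqrt (f y)) -/s; congr cmod; ring.
  have : 1 <= cmod (1 + s).
    apply: le_trans (Re_le_cmod _); rewrite Re_add Re_1.
    by apply: le_trans (ler_norm _); rewrite lerDl Re_sqrt_ge0.
  have := f1 _ Yy; have := cmod_ge0 (1 - s); nra.
apply: (@uclosure_contraction _ (fun=> 1) Phi (1 / 2)) => //.
- exact: uclosure_cst.
- move=> g Ag; apply: uclosure_add => //.
  apply: uclosure_mul; first exact: uclosure_cst.
  by apply: uclosure_sub => //; exact: uclosure_mul.
- move=> g y Yy ge; rewrite /Phi.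
  set s : C := sqrtc (f y) in ge *.
  rewrite -{1}(sqr_sqrt (f y)) -/s.
  have -> : g y + rtoc (1 / 2) * (s ^+ 2 - g y * g y) - s
    = ((1 - s) + rtoc (1 / 2) * (s - g y)) * (g y - s).
    by apply: cplx_ext; rewrite ?expr2 !ReImE; field.
  rewrite cmodM ler_wpM2r ?cmod_ge0 //.
  rewrite (le_trans (cmodD _ _)) // cmodM cmod_rtoc ger0_norm; last lra.
  rewrite [cmod (s - _)]cmodB; have := s1 _ Yy; rewrite -/s; lra.
Qed.

End UniformAlgebra.

(** * Square roots and Kallin's lemma *)

(** Power trick: it removes multiplicative constants from hull estimates. *)
Lemma le_of_expr_le (R : realType) (a M x c : R) : 0 < a -> 0 <= x -> 0 <= c ->
  (forall n : nat, a * x ^+ n <= M * c ^+ n) -> x <= c.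
Proof.
move=> a0 x0 c0 axM; rewrite leNgt; apply/negP => cx.
have x1 : 0 < x by exact: le_lt_trans cx.
have M0 : 0 < M by have := axM 0%N; rewrite !expr0; lra.
have [n] : exists n : nat, (c / x) ^+ n < a / M.
  apply: exprn_small; first exact: divr_ge0.
    by rewrite ltr_pdivrMr // mul1r.
  exact: divr_gt0.
rewrite expr_div_n ltr_pdivrMr ?exprn_gt0 // mulrAC ltr_pdivlMr // mulrC.
by rewrite ltNge axM.
Qed.

(** A continuity argument: from large [s], finitely many steps of ratio at least [r] reach any
    positive [s]. *)
Lemma downward_induction (R : realType) (Q : R -> Prop) (S r : R) :
  0 < S -> 0 < r -> r < 1 -> (forall s, S <= s -> Q s) ->
  (forall s s', 0 < s -> r * s <= s' -> s' <= s -> Q s -> Q s') ->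
  forall s, 0 < s -> Q s.
Proof.
move=> S0 r0 r1 QS Qr s s0.
have [n rn] : exists n : nat, r ^+ n < s / S.
  by apply: exprn_small; rewrite ?divr_gt0 // ltW.
have : S * r ^+ n <= s by rewrite mulrC -ler_pdivlMr // ltW.
elim: n s s0 {rn} => [|n IH] s s0; first by rewrite expr0 mulr1; exact: QS.
rewrite exprS => rs; have [|sr] := leP (S * r ^+ n) s; first exact: IH.
have Srn : 0 < S * r ^+ n by rewrite mulr_gt0 ?exprn_gt0.
by apply: Qr (IH _ Srn (lexx _)) => //; [lra | exact: ltW].
Qed.

Section SquareRoots.
Variable R : realType.
Implicit Types u w : Cplx R.

(** Let [v] be the root and take [s = |v|^2]: then [u + s = v^2 + v v^* = 2 v Re v]. *)
Lemma Re_sqrt_cone u (k : R) : (forall s, 0 < s -> k * s <= cmod (u + rtoc s)) ->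
  k / 2 * cmod (sqrtc u) <= complex.Re (sqrtc u).
Proof.
move=> uk; set v : Cplx R := sqrtc u.
have uv : u = v ^+ 2 by rewrite sqr_sqrt.
have [v0|v0] := eqVneq (cmod v) 0.
  by rewrite v0 mulr0 Re_sqrt_ge0.
have vp : 0 < cmod v by rewrite lt_def v0 cmod_ge0.
have v2 : 0 < cmod v ^+ 2 by rewrite exprn_gt0.
have := uk _ v2.
have -> : u + rtoc (cmod v ^+ 2) = v * rtoc (2 * complex.Re v).
  by apply: cplx_ext; rewrite uv !expr2 !ReImE -?expr2 ?cmod_sqr; ring.
rewrite cmodM cmod_rtoc ger0_norm ?mulr_ge0 ?Re_sqrt_ge0 // => h.
have : k * cmod v <= 2 * complex.Re v.
  by rewrite -(ler_pM2l vp); move: h; rewrite expr2; lra.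
lra.
Qed.

(** Only the sign of the real part of the product is in question. Adding a real number preserves
    imaginary parts, whereas [Re (x y) <= 0] would give [(x y)^2] and [x^2] imaginary parts of
    different signs. *)
Lemma sqrt_mul_near u w (s s' : R) : (u + rtoc s) * w = u + rtoc s' ->
  0 < complex.Re (sqrtc (u + rtoc s)) -> 0 < complex.Re (sqrtc w) ->
  (sqrtc (u + rtoc s) : Cplx R) * sqrtc w = sqrtc (u + rtoc s').
Proof.
move=> usw; set x : Cplx R := sqrtc (u + rtoc s); set y : Cplx R := sqrtc w.
move=> x0 y0.
have xyE : (x * y) ^+ 2 = u + rtoc s' by rewrite exprMn !sqr_sqrt.
have xE : x ^+ 2 = u + rtoc s by rewrite sqr_sqrt.
apply: sqrt_unique => //.
have : complex.Im ((x * y) ^+ 2) = complex.Im (x ^+ 2).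
  by rewrite xyE xE !ReImE.
rewrite !expr2 !ReImE; move: x0 y0.
move: (complex.Re x) (complex.Im x) (complex.Re y) (complex.Im y) => a b c d.
move=> a0 c0 h; rewrite ltNge; apply/negP => X0.
have ac : 0 < a * c by exact: mulr_gt0.
have bd : 0 < b * d by lra.
have [b0|b0] := leP b 0.
  have d0 : d < 0 by nra.
  have : 0 <= (a * c - b * d) * (a * d + b * c).
    by rewrite mulr_le0 //; nra.
  have : a * b < 0 by rewrite pmulr_rlt0 //; nra.
  lra.
have d0 : 0 < d by nra.
have : (a * c - b * d) * (a * d + b * c) <= 0.
  by rewrite mulr_le0_ge0 //; nra.
have : 0 < a * b by rewrite mulr_gt0.
lra.
Qed.

Lemma Re_sqrt_near1 w : cmod (1 - w) <= 1 / 2 -> 0 < complex.Re (sqrtc w).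
Proof.
move=> w1; set v : Cplx R := sqrtc w.
have : complex.Re (1 - w) <= 1 / 2.
  by apply: le_trans w1; apply: le_trans (Re_le_cmod _); exact: ler_norm.
have -> : w = v ^+ 2 by rewrite sqr_sqrt.
rewrite lt_def Re_sqrt_ge0 andbT expr2 !ReImE => h.
by apply/eqP => v0; move: h; rewrite v0; have := sqr_ge0 (complex.Im v); nra.
Qed.

End SquareRoots.

(** At the point on the middle ray, [Im - k0 Re] and [k1 Re - |Im|] both equal [(k1 - k0) s / 2].
    They change by at most [1 + k1] times the distance, and one of them is nonpositive at [z]. *)
Lemma cone_dist (R : realType) (k0 k1 s : R) (z : Cplx R) :
  0 <= k0 -> k0 < k1 -> 0 < s ->
  `|complex.Im z| <= k0 * complex.Re z \/ k1 * complex.Re z <= `|complex.Im z| ->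
  (k1 - k0) / 2 * s <= (1 + k1) * cmod (z - rtoc s * ((1 +i* ((k0 + k1) / 2))%C : Cplx R)).
Proof.
move=> k00 k01 s0; set w := z - _; set r := cmod w.
have r0 : 0 <= r by exact: cmod_ge0.
have := Re_le_cmod w; have := Im_le_cmod w; rewrite -/r !ler_norml.
rewrite /w !ReImE /=.
move: (complex.Re z) (complex.Im z) => a b /andP[h1 h2] /andP[h3 h4].
have k0r : 0 <= k0 * r by exact: mulr_ge0.
have k1r : k0 * r <= k1 * r by rewrite ler_wpM2r // ltW.
case; rewrite ?ler_norml.
  by move=> /andP[h5 h6]; nra.
have [b0|b0] := leP 0 b; first by rewrite ger0_norm // => h5; nra.
by rewrite ltr0_norm // => h5; nra.
Qed.

Section Kallin.
Variables (R : realType) (T : Type).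
Local Notation C := (Cplx R).
Variables (P : (T -> C) -> Prop) (K : set T).
Hypotheses (PA : func_alg P) (bK : bounded_on P K).
Let Y := hull P K.
Let A := uclosure P Y.

(** * Inverses and roots of functions avoiding a sector about the negative axis *)

Section Cone.
Variables (phi : T -> C) (k : R).
Hypotheses (Aphi : A phi) (k0 : 0 < k) (k1 : k <= 1).
Hypothesis phi_cone : forall x s, K x -> 0 < s -> k * s <= cmod (phi x + rtoc s).

(** Nonvanishing is stated separately: with [0^-1 = 0], membership of the inverse would not exclude
    zeros on the hull. *)
Let inverse_at s := (forall y, Y y -> phi y + rtoc s != 0) /\
  A (fun x => (phi x + rtoc s)^-1).

Lemma uclosure_shift s : A (fun x => phi x + rtoc s).
Proof. by apply: (uclosure_add PA) => //; exact: uclosure_cst. Qed.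

(** The maximum principle for the inverse turns a lower bound on [K] into one on the hull. *)
Lemma inverse_at_bound s : 0 < s -> inverse_at s ->
  forall y, Y y -> k * s <= cmod (phi y + rtoc s).
Proof.
move=> s0 [phi0 Ainv] y Yy; have ks : 0 < k * s by exact: mulr_gt0.
have : cmod (phi y + rtoc s)^-1 <= (k * s)^-1.
  apply: (uclosure_hull Ainv _ Yy) => x Kx.
  rewrite cmodV lef_pV2 ?posrE ?phi_cone //.
  by rewrite cmod_gt0 phi0 //; exact: subset_hull.
by rewrite cmodV lef_pV2 // posrE cmod_gt0 phi0.
Qed.

Lemma quotient_near1 s s' : 0 < s -> (1 - k / 2) * s <= s' -> s' <= s ->
  inverse_at s ->
  forall y, Y y -> cmod (1 - (phi y + rtoc s') / (phi y + rtoc s)) <= 1 / 2.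
Proof.
move=> s0 ss' s's Is y Yy; have phi0 := Is.1 _ Yy.
have -> : 1 - (phi y + rtoc s') / (phi y + rtoc s)
    = rtoc (s - s') / (phi y + rtoc s).
  have -> : rtoc (s - s') = (phi y + rtoc s) - (phi y + rtoc s').
    by apply: cplx_ext; rewrite !ReImE; ring.
  by field.
rewrite cmodM cmodV cmod_rtoc ger0_norm ?subr_ge0 //.
rewrite ler_pdivrMr ?cmod_gt0 //.
have := inverse_at_bound s0 Is Yy; lra.
Qed.

Lemma uclosure_quotient s s' : inverse_at s ->
  A (fun x => (phi x + rtoc s') / (phi x + rtoc s)).
Proof.
move=> [_ Ainv].
exact: (uclosure_mul PA bK (uclosure_shift s') Ainv).
Qed.

Lemma rescaled_near1 : exists2 S, 0 < S & forall s, S <= s -> 0 < s /\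
  forall y, Y y -> cmod (1 - (phi y + rtoc s) * rtoc s^-1) <= 1 / 2.
Proof.
have [M M0 phiM] := hull_bounded bK Aphi.
exists (2 * M) => [|s Ms]; first exact: mulr_gt0.
have s0 : 0 < s by apply: lt_le_trans Ms; exact: mulr_gt0.
split=> // y Yy.
have -> : 1 - (phi y + rtoc s) * rtoc s^-1 = - phi y * rtoc s^-1.
  rewrite mulrDl -rtocM divff ?gt_eqF //.
  have -> : rtoc (1 : R) = 1 by [].
  by ring.
rewrite cmodM cmodN cmod_rtoc gtr0_norm ?invr_gt0 // ler_pdivrMr //.
have := phiM _ Yy; lra.
Qed.

Lemma uclosure_rescaled s : A (fun x => (phi x + rtoc s) * rtoc s^-1).
Proof.
apply: (uclosure_mul PA bK); first exact: uclosure_shift.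
exact: uclosure_cst.
Qed.

(** Descent in [s]: for large [s] the function is a small perturbation of a constant, and each step
    multiplies the inverse by that of a quotient close to 1. [inverse_at_bound] keeps the step ratio
    independent of [s]. *)
Lemma inverse_atP s : 0 < s -> inverse_at s.
Proof.
have [r0 r1] : 0 < 1 - k / 2 /\ 1 - k / 2 < 1.
  by move: k0 k1 => ? ?; split; lra.
have [S S0 HS] := rescaled_near1.
apply: (@downward_induction _ inverse_at S (1 - k / 2)) => //.
- move=> {}s Ss; have [s0 near] := HS _ Ss.
  have nz y : Y y -> (phi y + rtoc s) * rtoc s^-1 != 0.
    by move=> Yy; have := cmod_near1 (near _ Yy); rewrite -cmod_gt0; lra.
  split.
    by move=> y /nz; apply: contra => /eqP ->; rewrite mul0r.
  have := uclosure_inv_near1 PA bK (uclosure_rescaled s) near.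
  move=> /(uclosure_mul PA bK (uclosure_cst K PA (rtoc s^-1))).
  apply: uclosure_eq => y Yy; have := nz _ Yy.
  by rewrite mulf_eq0 negb_or => /andP[_ z]; rewrite invfM mulrCA divff ?mulr1.
- move=> {}s s' s0 ss' s's Is.
  have near := quotient_near1 s0 ss' s's Is.
  have nz y : Y y -> (phi y + rtoc s') / (phi y + rtoc s) != 0.
    by move=> Yy; have := cmod_near1 (near _ Yy); rewrite -cmod_gt0; lra.
  split.
    by move=> y /nz; apply: contra => /eqP ->; rewrite mul0r.
  have := uclosure_inv_near1 PA bK (uclosure_quotient s' Is) near.
  move=> /(uclosure_mul PA bK Is.2).
  apply: uclosure_eq => y Yy; have := nz _ Yy; have := Is.1 _ Yy => z0.
  by rewrite mulf_eq0 negb_or => /andP[z1 z2]; field; rewrite z1.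
Qed.

Lemma hull_cone y s : Y y -> 0 < s -> k * s <= cmod (phi y + rtoc s).
Proof. by move=> Yy s0; apply: inverse_at_bound => //; exact: inverse_atP. Qed.

Lemma shift_cone y s : Y y -> 0 < s ->
  forall s', 0 < s' -> k * s' <= cmod (phi y + rtoc s + rtoc s').
Proof.
move=> Yy s0 s' s'0.
have -> : phi y + rtoc s + rtoc s' = phi y + rtoc (s + s').
  by apply: cplx_ext; rewrite !ReImE; ring.
apply: le_trans (hull_cone Yy (addr_gt0 s0 s'0)).
by rewrite ler_pM2l // lerDr ltW.
Qed.

Lemma Re_sqrt_shift y s : Y y -> 0 < s ->
  0 < complex.Re (sqrtc (phi y + rtoc s)).
Proof.
move=> Yy s0; apply: lt_le_trans (Re_sqrt_cone (shift_cone Yy s0)).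
rewrite mulr_gt0 ?divr_gt0 // (@cmod_gt0 _ (sqrtc _)) sqrtc_eq0.
by have [] := inverse_atP s0 => + _; apply.
Qed.

(** The same descent with the root of the quotient; [sqrt_mul_near] makes the branches agree. *)
Lemma uclosure_sqrt_shift s : 0 < s -> A (fun x => sqrtc (phi x + rtoc s)).
Proof.
have [r0 r1] : 0 < 1 - k / 2 /\ 1 - k / 2 < 1.
  by move: k0 k1 => ? ?; split; lra.
have [S S0 HS] := rescaled_near1.
move: s; apply: (@downward_induction _
  (fun s => A (fun x => sqrtc (phi x + rtoc s))) S (1 - k / 2)) => //.
- move=> s Ss; have [s0 near] := HS _ Ss.
  have := uclosure_sqrt_near1 PA bK (uclosure_rescaled s) near.
  move=> /(uclosure_mul PA bK (uclosure_cst K PA (rtoc (Num.sqrt s)))).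
  apply: uclosure_eq => y Yy; apply: sqrt_unique.
    rewrite exprMn sqr_sqrt [_ ^+ 2]expr2 -rtocM -expr2 sqr_sqrtr ?ltW //.
    rewrite mulrCA -rtocM divff ?gt_eqF //.
    by have -> : rtoc (1 : R) = 1 by []; rewrite mulr1.
  rewrite Re_mul Re_rtoc Im_rtoc mul0r subr0 mulr_gt0 ?sqrtr_gt0 //.
  exact: Re_sqrt_near1 (near _ Yy).
- move=> s s' s0 ss' s's Ah; have Is := inverse_atP s0.
  have near := quotient_near1 s0 ss' s's Is.
  have := uclosure_sqrt_near1 PA bK (uclosure_quotient s' Is) near.
  move=> /(uclosure_mul PA bK Ah).
  apply: uclosure_eq => y Yy; apply: sqrt_mul_near.
  + by field; exact: Is.1.
  + exact: Re_sqrt_shift.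
  + exact: Re_sqrt_near1 (near _ Yy).
Qed.

Lemma uclosure_sqrt : A (fun x => sqrtc (phi x)).
Proof.
apply: uclosure_lim => e e0.
(* The estimates below give [|a - b|^2 <= 4 s / k^3], which this [s] makes equal to [e^2]. *)
pose s := e ^+ 2 * k ^+ 3 / 4.
have s0 : 0 < s by rewrite divr_gt0 ?mulr_gt0 ?exprn_gt0.
exists (fun x => sqrtc (phi x + rtoc s)); first exact: uclosure_sqrt_shift.
move=> y Yy; set a : C := sqrtc _; set b : C := sqrtc _.
have ab : cmod (a - b) * cmod (a + b) = s.
  rewrite -cmodM.
  have -> : (a - b) * (a + b) = a ^+ 2 - b ^+ 2 by ring.
  rewrite !sqr_sqrt; have -> : phi y + rtoc s - phi y = rtoc s by ring.
  by rewrite cmod_rtoc gtr0_norm.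
have a2 : k * s <= cmod a ^+ 2 by rewrite -cmodX sqr_sqrt hull_cone.
have aRe : k / 2 * cmod a <= cmod (a + b).
  apply: le_trans (Re_sqrt_cone (shift_cone Yy s0)) _.
  apply: le_trans (Re_le_cmod _); apply: le_trans (ler_norm _).
  by rewrite Re_add lerDl Re_sqrt_ge0.
rewrite -(@ler_pXn2r _ 2) ?nnegrE ?cmod_ge0 ?(ltW e0) //.
have h1 : cmod (a - b) * (k / 2 * cmod a) <= s.
  by rewrite -ab ler_wpM2l ?cmod_ge0.
have h2 : (cmod (a - b) * (k / 2 * cmod a)) ^+ 2 <= s ^+ 2.
  by rewrite ler_pXn2r ?nnegrE ?(ltW s0) ?mulr_ge0 ?cmod_ge0 ?divr_ge0 ?(ltW k0).
have h3 : cmod (a - b) ^+ 2 * (k ^+ 2 / 4 * (k * s)) <= s ^+ 2.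
  apply: le_trans h2; rewrite !exprMn; rewrite ler_wpM2l ?sqr_ge0 //.
  have -> : k ^+ 2 / 4 = k ^+ 2 * 2^-1 ^+ 2 by field.
  by rewrite ler_wpM2l // mulr_ge0 ?sqr_ge0.
have k3 : 0 < k ^+ 3 / 4 * s.
  by apply: mulr_gt0 => //; apply: divr_gt0 => //; exact: exprn_gt0.
rewrite -(ler_pM2r k3).
have -> : cmod (a - b) ^+ 2 * (k ^+ 3 / 4 * s)
    = cmod (a - b) ^+ 2 * (k ^+ 2 / 4 * (k * s)) by field.
apply: le_trans h3 _; rewrite le_eqVlt; apply/orP; left; apply/eqP.
by rewrite /s; field.
Qed.

End Cone.

(** As [g] vanishes on [K] off [L], the products [g h^n] are bounded by [M c^n] on [K], hence at
    [q], for all [n]. A negative [c] forces [L] to be empty, and then [g q = 0]. *)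
Lemma hull_of_weight (L : set T) (g : T -> C) q : A g -> Y q -> g q != 0 ->
  (forall x, K x -> L x \/ g x = 0) -> hull P L q.
Proof.
move=> Ag Yq gq Lg h c Ph hc.
have [M M0 gM] := hull_bounded bK Ag.
have gq0 : 0 < cmod (g q) by rewrite cmod_gt0.
have [c0|c0] := leP 0 c.
  apply: (le_of_expr_le gq0 (cmod_ge0 _) c0 (M := M)) => n.
  rewrite -cmodX -cmodM.
  have Agh := uclosure_mul PA bK Ag (uclosure_exp PA bK n (uclosure_P K Ph)).
  apply: (uclosure_hull Agh _ Yq) => x Kx.
  have [Lx|->] := Lg _ Kx; last first.
    by rewrite mul0r cmod0 mulr_ge0 ?(ltW M0) ?exprn_ge0.
  rewrite cmodM cmodX ler_pM ?cmod_ge0 ?exprn_ge0 ?cmod_ge0 //.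
    by apply: gM; exact: subset_hull.
  by apply: lerXn2r; rewrite ?nnegrE ?cmod_ge0 // hc.
have : cmod (g q) <= 0; last by rewrite leNgt gq0.
apply: (uclosure_hull Ag _ Yq) => x Kx.
have [Lx|->] := Lg _ Kx; last by rewrite cmod0.
by have := le_trans (cmod_ge0 _) (hc _ Lx); rewrite leNgt c0.
Qed.


(* [sqrtc (- f / E)] and [sqrtc (- f / E')], where [E'] is the conjugate of
   [E], have their cuts where [f] lies on the ray through [E], respectively
   [E']. Up to a constant factor, their product is [- f] outside the sector
   between the two rays and [f] inside it, so it separates the two cones. *)
Lemma kallin (K0 K1 : set T) (k0 k1 : R) (f : T -> C) q :
  P f -> 0 < k0 -> k0 < k1 ->
  (forall x, K x ->
     (K0 x /\ `|complex.Im (f x)| <= k0 * complex.Re (f x)) \/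
     (K1 x /\ k1 * complex.Re (f x) <= `|complex.Im (f x)|)) ->
  Y q -> f q != 0 -> hull P K0 q \/ hull P K1 q.
Proof.
move=> Pf k00 k01 Kf Yq fq.
pose k := (k0 + k1) / 2.
have kp : 0 < k by rewrite /k; lra.
pose E : C := (1 +i* k)%C; pose E' : C := (1 +i* (- k))%C.
pose c := cmod E; pose d := (k1 - k0) / 2 / ((1 + k1) * c).
have EE' : E * E' = rtoc (c ^+ 2).
  by apply: cplx_ext; rewrite /c cmod_sqr !ReImE /=; ring.
have c1 : 1 <= c.
  by apply: cmod_ge_sqr => //=; rewrite lerDl sqr_ge0.
have c0 : 0 < c by lra.
have E'c : cmod E' = c by rewrite /c /cmod /= sqrrN.
have E0 : E != 0 by rewrite -cmod_gt0.
have E'0 : E' != 0 by rewrite -cmod_gt0 E'c.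
have k1c : 0 < (1 + k1) * c by apply: mulr_gt0 => //; lra.
have d0 : 0 < d by apply: divr_gt0 => //; lra.
have d1 : d <= 1.
  by rewrite ler_pdivrMr // mul1r; have : 1 + k1 <= (1 + k1) * c; nra.
have Aphi (e : C) : A (fun x => - f x / e).
  apply: uclosure_P; apply: (alg_mul PA); last exact: alg_cst PA _.
  exact: alg_opp.
have key (z e : C) s : e != 0 -> cmod e = c ->
    (k1 - k0) / 2 * s <= (1 + k1) * cmod (z - rtoc s * e) ->
    d * s <= cmod (- z / e + rtoc s).
  move=> e0 ec h.
  have -> : - z / e + rtoc s = - ((z - rtoc s * e) / e) by field.
  have k11 : 0 < 1 + k1 by lra.
  rewrite cmodN cmodM cmodV ec ler_pdivlMr //.
  have -> : d * s * c = (k1 - k0) / 2 * s / (1 + k1).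
    by rewrite /d; field; rewrite !gt_eqF.
  by rewrite ler_pdivrMr // [leRHS]mulrC.
have reg x : K x -> `|complex.Im (f x)| <= k0 * complex.Re (f x) \/
    k1 * complex.Re (f x) <= `|complex.Im (f x)|.
  by move=> /Kf[[_ ?]|[_ ?]]; [left|right].
have cone1 x s : K x -> 0 < s -> d * s <= cmod (- f x / E + rtoc s).
  by move=> Kx s0; apply: key => //; apply: cone_dist (ltW k00) k01 s0 (reg _ Kx).
have cone2 x s : K x -> 0 < s -> d * s <= cmod (- f x / E' + rtoc s).
  move=> Kx s0; apply: key => //.
  have := @cone_dist _ k0 k1 s (Num.conj (f x)) (ltW k00) k01 s0.
  rewrite Re_cconj Im_cconj normrN => /(_ (reg _ Kx)).
  congr (_ <= _ * _); rewrite /cmod -/(cmod _).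
  have -> : f x - rtoc s * E' = Num.conj (Num.conj (f x) - rtoc s * E).
    by apply: cplx_ext; rewrite !ReImE /=; ring.
  by apply/eqP; rewrite -(@eqrXn2 _ 2) ?cmod_ge0 // !cmod_sqr !ReImE sqrrN.
pose r1 x : C := sqrtc (- f x / E); pose r2 x : C := sqrtc (- f x / E').
have Ar1 : A r1 by exact: (@uclosure_sqrt _ d).
have Ar2 : A r2 by exact: (@uclosure_sqrt _ d).
(* The factor [c] makes [B^2 = f^2], as [E E' = c^2]. *)
pose B x : C := rtoc c * (r1 x * r2 x).
have AB : A B.
  apply: (uclosure_mul PA bK); first exact: uclosure_cst.
  exact: (uclosure_mul PA bK).
have r1E x : r1 x ^+ 2 = - f x / E by rewrite /r1 sqr_sqrt.
have r2E x : r2 x ^+ 2 = - f x / E' by rewrite /r2 sqr_sqrt.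
have B2 x : B x = f x \/ B x = - f x.
  have /eqP : B x ^+ 2 = f x ^+ 2.
    rewrite /B !exprMn r1E r2E expr2 -rtocM -expr2 -EE'; field.
    by rewrite E0 E'0.
  by rewrite eqf_sqr => /orP[] /eqP; [left|right].
have Re1 x : K x -> f x != 0 -> 0 < complex.Re (r1 x).
  move=> Kx fx; have := Re_sqrt_cone (fun s => @cone1 x s Kx).
  apply: lt_le_trans; apply: mulr_gt0; first exact: divr_gt0.
  by rewrite cmod_gt0 sqrtc_eq0 mulf_neq0 ?invr_eq0 ?oppr_eq0.
have Re2 x : K x -> f x != 0 -> 0 < complex.Re (r2 x).
  move=> Kx fx; have := Re_sqrt_cone (fun s => @cone2 x s Kx).
  apply: lt_le_trans; apply: mulr_gt0; first exact: divr_gt0.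
  by rewrite cmod_gt0 sqrtc_eq0 mulf_neq0 ?invr_eq0 ?oppr_eq0.
have fE x : f x = - (r1 x * (r1 x * E)).
  by rewrite mulrA -expr2 r1E; field.
(* From [f = - r1^2 E] and [B = e f] follows [c r2 = - e r1 E], so the positive real part of [r2]
   decides the sign [e]. *)
have r2c x (e : R) : f x != 0 -> B x = rtoc e * f x ->
    rtoc c * r2 x = rtoc (- e) * (r1 x * E).
  move=> fx Bx; have r10 : r1 x != 0.
    by apply: contra fx => /eqP h; rewrite fE h mul0r oppr0.
  apply: (mulfI r10); rewrite mulrCA -/(B x) Bx {1}fE.
  by apply: cplx_ext; rewrite !ReImE; ring.
have sg x (e : R) : K x -> f x != 0 -> B x = rtoc e * f x ->
    0 < - e * complex.Re (r1 x * E).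
  move=> Kx fx /(r2c _ _ fx) /(congr1 (@complex.Re R)).
  rewrite [X in X = _]Re_mul [X in _ = X]Re_mul !Re_rtoc !Im_rtoc !mul0r !subr0.
  by move=> <-; rewrite mulr_gt0 ?Re2.
(* Write [r1 = a + b i] and [r1 E = V + W i]; [e1] and [e2] compute [k Re f - Im f] and
   [k Re f + Im f], both positive in the inner sector. If [B = - f], then [V > 0], while [e1] gives
   [b > 0], so [W > 0], against [e2 = - 2 V W]. *)
have in0 x : K x -> `|complex.Im (f x)| <= k0 * complex.Re (f x) -> B x = f x.
  move=> Kx hx; have [fx|fx] := eqVneq (f x) 0.
    by have [->|->] := B2 x; rewrite ?fx ?oppr0.
  have [//|Bx] := B2 x; exfalso.
  have Bx' : B x = rtoc (-1) * f x.
    by rewrite Bx; apply: cplx_ext; rewrite !ReImE; ring.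
  have := sg _ _ Kx fx Bx'; have := Re1 _ Kx fx.
  have : 0 < complex.Re (f x).
    rewrite lt_def; apply/andP; split; last first.
      by rewrite -(pmulr_rge0 _ k00) (le_trans (normr_ge0 _) hx).
    apply: contra fx => /eqP f0; apply/eqP; apply: cplx_ext => //.
    by apply/eqP; rewrite -normr_le0 (le_trans hx) // f0 mulr0.
  move: hx; rewrite (fE x) ler_norml !ReImE /= -/k.
  move: (complex.Re (r1 x)) (complex.Im (r1 x)) => a b.
  have k0k : k0 < k by rewrite /k; lra.
  rewrite !mulr1; set V := a - b * k; set W := a * k + b.
  rewrite opprB opprD => /andP[h1 h2] A0 a0 V0.
  have k0A : k0 * (b * W - a * V) < k * (b * W - a * V) by rewrite ltr_pM2r.
  have e1 : k * (b * W - a * V) - (- (a * W) - b * V) = 2 * (a * b) * (1 + k ^+ 2).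
    by rewrite /V /W; ring.
  have e2 : k * (b * W - a * V) + (- (a * W) - b * V) = - (2 * V * W).
    by rewrite /V /W; ring.
  have k2 : 0 < 1 + k ^+ 2 by rewrite ltr_wpDr ?sqr_ge0.
  have : 0 < 2 * (a * b) * (1 + k ^+ 2) by rewrite -e1; lra.
  rewrite pmulr_lgt0 // pmulr_rgt0 // pmulr_rgt0 // => b0.
  have W0 : 0 < W by apply: addr_gt0 => //; exact: mulr_gt0.
  have V1 : 0 < V by move: V0; rewrite opprK mul1r.
  have : 0 < V * W by exact: mulr_gt0.
  move: h1 h2 k0A e2; clear; lra.
(* If [B = f], then [V < 0], which forces [b > 0] and [W > 0]. Now [e1] and [e2] are positive, so
   [f] lies inside the middle sector, against the slope [k1]. *)
have in1 x : K x -> k1 * complex.Re (f x) <= `|complex.Im (f x)| -> B x = - f x.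
  move=> Kx hx; have [fx|fx] := eqVneq (f x) 0.
    by have [->|->] := B2 x; rewrite ?fx ?oppr0.
  have [Bx|//] := B2 x; exfalso.
  have Bx' : B x = rtoc 1 * f x.
    by rewrite Bx; apply: cplx_ext; rewrite !ReImE; ring.
  have := sg _ _ Kx fx Bx'; have := Re1 _ Kx fx.
  move: hx; rewrite (fE x) !ReImE /= -/k.
  move: (complex.Re (r1 x)) (complex.Im (r1 x)) => a b.
  have kk1 : k < k1 by rewrite /k; lra.
  rewrite !mulr1; set V := a - b * k; set W := a * k + b.
  rewrite opprB opprD => h a0 V0.
  have b0 : 0 < b by rewrite -(pmulr_lgt0 _ kp); rewrite /V in V0; lra.
  have e1 : k * (b * W - a * V) - (- (a * W) - b * V) = 2 * (a * b) * (1 + k ^+ 2).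
    by rewrite /V /W; ring.
  have e2 : k * (b * W - a * V) + (- (a * W) - b * V) = 2 * (- V * W).
    by rewrite /V /W; ring.
  have k2 : 0 < 1 + k ^+ 2 by rewrite ltr_wpDr ?sqr_ge0.
  have p1 : 0 < 2 * (a * b) * (1 + k ^+ 2) by rewrite !mulr_gt0.
  have W0 : 0 < W by apply: addr_gt0 => //; exact: mulr_gt0.
  have V1 : 0 < - V by move: V0; rewrite mulN1r.
  have p2 : 0 < 2 * (- V * W) by rewrite mulr_gt0 ?mulr_gt0.
  have : `|- (a * W) - b * V| < k * (b * W - a * V).
    by rewrite ltr_norml; apply/andP; split; lra.
  move=> h2; have A0 : 0 < b * W - a * V.
    by rewrite -(pmulr_rgt0 _ kp) (le_lt_trans _ h2).
  have : k * (b * W - a * V) < k1 * (b * W - a * V) by rewrite ltr_pM2r.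
  lra.
have Af := uclosure_P K Pf : A f.
(* By [in0] and [in1], [f + B] vanishes on [K] off [K0] and [f - B] on [K] off [K1]; one of them is
   nonzero at [q]. *)
have [Bq|Bq] := B2 q; [left|right].
  apply: (@hull_of_weight _ (fun x => f x + B x) q) => //.
  - exact: (uclosure_add PA).
  - by rewrite Bq -mulr2n mulrn_eq0.
  - move=> x Kx; have [[]|[K1x hx]] := Kf _ Kx; first by left.
    by right; rewrite in1 // subrr.
apply: (@hull_of_weight _ (fun x => f x - B x) q) => //.
- exact: (uclosure_sub PA bK).
- by rewrite Bq opprK -mulr2n mulrn_eq0.
- move=> x Kx; have [[K0x hx]|[]] := Kf _ Kx; last by left.
  by right; rewrite in0 // subrr.
Qed.

End Kallin.

(** * Polynomials in two variables *)

Section TwoVariables.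
Variable R : realType.
Local Notation C := (Cplx R).
Implicit Types (f g : C * C -> C) (K : set (C * C)).

(** The inductive form allows induction on the function. Each member is the evaluation of an
    [mpoly], so [poly_hull] is contained in the hull for this class. *)
Inductive pol2 : (C * C -> C) -> Prop :=
| pol2_cst c : pol2 (fun=> c)
| pol2_fst : pol2 fst
| pol2_snd : pol2 snd
| pol2_add f g : pol2 f -> pol2 g -> pol2 (fun v => f v + g v)
| pol2_mul f g : pol2 f -> pol2 g -> pol2 (fun v => f v * g v).

Lemma pol2_alg : func_alg pol2.
Proof. by split; [exact: pol2_cst | exact: pol2_add | exact: pol2_mul]. Qed.

Lemma pol2_exp f n : pol2 f -> pol2 (fun v => f v ^+ n).
Proof. by move=> Pf; exact (alg_exp pol2_alg n Pf). Qed.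

Lemma pol2_comp f g h : pol2 f -> pol2 g -> pol2 h ->
  pol2 (fun v => f (g v, h v)).
Proof.
move=> Pf Pg Ph.
elim: Pf => [c|||f1 f2 _ IH1 _ IH2|f1 f2 _ IH1 _ IH2] //=.
- exact: pol2_cst.
- exact: pol2_add IH1 IH2.
- exact: pol2_mul IH1 IH2.
Qed.

Lemma pol2_mpoly f : pol2 f -> exists p : mpoly.mpoly 2 C,
  forall v : 'rV[C]_2, peval p v = f (v ord0 ord0, v ord0 ord_max).
Proof.
elim=> [c|||f1 f2 _ [p1 E1] _ [p2 E2]|f1 f2 _ [p1 E1] _ [p2 E2]].
- by exists (mpoly.mpolyC 2 c) => v; exact: mpoly.mevalC.
- by exists (mpoly.mpolyX C (mpoly.mnm1 ord0)) => v; exact: mpoly.mevalXU.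
- by exists (mpoly.mpolyX C (mpoly.mnm1 ord_max)) => v; exact: mpoly.mevalXU.
- by exists (p1 + p2) => v; rewrite -E1 -E2; exact: mpoly.mevalD.
- by exists (p1 * p2) => v; rewrite -E1 -E2; exact: mpoly.mevalM.
Qed.

Lemma pol2_bounded K (a b : R) :
  (forall v, K v -> cmod v.1 <= a /\ cmod v.2 <= b) -> bounded_on pol2 K.
Proof.
move=> Kab f; elim=> [c|||f1 f2 _ [M1 E1] _ [M2 E2]|f1 f2 _ [M1 E1] _ [M2 E2]].
- by exists (cmod c).
- by exists a => v /Kab[].
- by exists b => v /Kab[].
- exists (M1 + M2) => v Kv; apply: le_trans (cmodD _ _) _.
  by rewrite lerD ?E1 ?E2.
- exists (M1 * M2) => v Kv.
  by rewrite cmodM ler_pM ?cmod_ge0 ?E1 ?E2.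
Qed.

Definition coords (K : set 'rV[C]_2) : set (C * C) :=
  [set v | exists2 x, K x & v = (x ord0 ord0, x ord0 ord_max)].

Lemma poly_hull_coords (K : set 'rV[C]_2) q : poly_hull K q ->
  hull pol2 (coords K) (q ord0 ord0, q ord0 ord_max).
Proof.
move=> Kq f c /pol2_mpoly[p pE] fc; rewrite -pE -lee_fin.
apply: le_trans (Kq p) _; apply: ge_ereal_sup => _ [x Kx <-].
by rewrite lee_fin pE; apply: fc; exists x.
Qed.

(** Monomials are sorted by the exponent of [y] modulo 3, which gives the components under
    [y -> cr y]. *)
Lemma pol2_cube_split f : pol2 f -> exists f0 f1 f2,
  [/\ pol2 f0, pol2 f1, pol2 f2 & forall z y : C,
    f (z, y) = f0 (z, y ^+ 3) + y * f1 (z, y ^+ 3) + y ^+ 2 * f2 (z, y ^+ 3)].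
Proof.
have p0 := pol2_cst 0; have p1 := pol2_cst 1.
elim=> {f} [c|||f g _ [f0 [f1 [f2 [P0 P1 P2 fE]]]] _ [g0 [g1 [g2 [Q0 Q1 Q2 gE]]]]
           |f g _ [f0 [f1 [f2 [P0 P1 P2 fE]]]] _ [g0 [g1 [g2 [Q0 Q1 Q2 gE]]]]].
- exists (fun=> c), (fun=> 0), (fun=> 0); split=> //; first exact: pol2_cst.
  by move=> z y; ring.
- exists fst, (fun=> 0), (fun=> 0); split=> //; first exact: pol2_fst.
  by move=> z y /=; ring.
- exists (fun=> 0), (fun=> 1), (fun=> 0); split=> //.
  by move=> z y /=; ring.
- exists (fun v => f0 v + g0 v), (fun v => f1 v + g1 v), (fun v => f2 v + g2 v).
  split; try exact: pol2_add.
  by move=> z y; rewrite fE gE; ring.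
- exists (fun v => f0 v * g0 v + v.2 * (f1 v * g2 v + f2 v * g1 v)),
    (fun v => f0 v * g1 v + f1 v * g0 v + v.2 * (f2 v * g2 v)),
    (fun v => f0 v * g2 v + f1 v * g1 v + f2 v * g0 v).
  have ps := pol2_snd.
  split; try by repeat (apply: pol2_add || apply: pol2_mul).
  by move=> z y /=; rewrite fE gE; ring.
Qed.

Lemma cube_root_coords (e : C) : e ^+ 3 = 1 -> e != 1 ->
  complex.Re e = - (1 / 2) /\ complex.Im e ^+ 2 = 3 / 4.
Proof.
move=> e3 e1.
have : (e - 1) * (e ^+ 2 + e + 1) = 0 by rewrite -[RHS](subrr 1) -{3}e3; ring.
move/eqP; rewrite mulf_eq0 subr_eq0 (negbTE e1) /= => /eqP h.
have := congr1 (@complex.Re R) h; have := congr1 (@complex.Im R) h.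
rewrite expr2 !ReImE.
move: (complex.Re e) (complex.Im e) => a b h1 h2.
have : b * (2 * a + 1) = 0 by lra.
move/eqP; rewrite mulf_eq0 => /orP[/eqP b0|/eqP a1].
  by move: h2; rewrite b0; have := sqr_ge0 (a + 1 / 2); rewrite expr2; lra.
have a2 : a = - (1 / 2) by lra.
by split=> //; rewrite a2 in h2; rewrite expr2; lra.
Qed.

Definition cr : C := Complex (- (1 / 2)) (Num.sqrt 3 / 2).

Lemma Re_cr : complex.Re cr = - (1 / 2). Proof. by []. Qed.
Lemma Im_cr : complex.Im cr = Num.sqrt 3 / 2. Proof. by []. Qed.

Lemma cr2E : cr ^+ 2 = - 1 - cr.
Proof.
have h : Num.sqrt (3 : R) ^+ 2 = 3 by rewrite sqr_sqrtr.
move: Re_cr Im_cr; move: cr => w a b; rewrite expr2 in h *.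
by apply: cplx_ext; rewrite !ReImE a b; lra.
Qed.

Lemma cr3 : cr ^+ 3 = 1.
Proof. by rewrite exprS cr2E mulrBr -expr2 cr2E; ring. Qed.

Lemma cube_rootP (e : C) : e ^+ 3 = 1 -> [\/ e = 1, e = cr | e = cr ^+ 2].
Proof.
move=> e3; have [->|e1] := eqVneq e 1; first by constructor 1.
have [ea eb] := cube_root_coords e3 e1.
have h : Num.sqrt (3 : R) ^+ 2 = 3 by rewrite sqr_sqrtr.
have : complex.Im e ^+ 2 = (Num.sqrt 3 / 2) ^+ 2.
  by rewrite eb expr_div_n h; field.
move/eqP; rewrite eqf_sqr => /orP[] /eqP b; [constructor 2|constructor 3].
  exact: cplx_ext.
rewrite cr2E; move: Re_cr Im_cr; move: cr => w c d.
by apply: cplx_ext; rewrite !ReImE ?c ?d ?ea ?b; lra.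
Qed.

Lemma cube_root_cmod (e : C) : e ^+ 3 = 1 -> cmod e = 1.
Proof.
move=> /(congr1 (@cmod R)); rewrite cmodX cmod1 => /eqP.
by rewrite pexpr_eq1 ?cmod_ge0 // => /eqP.
Qed.

(** * Hulls under the threefold branched cover *)

Section Pullback.
Variables (s : C) (K : set (C * C)).
Hypothesis s0 : s != 0.

Definition cubic_pullback : set (C * C) :=
  [set v | K (v.1, (v.2 ^+ 3 - v.1 ^+ 3) / s)].

Let cubed (v : C * C) := s * v.2 + v.1 ^+ 3.

Lemma pol2_cubed : pol2 cubed.
Proof.
apply: pol2_add; last exact/pol2_exp/pol2_fst.
exact/pol2_mul/pol2_snd/pol2_cst.
Qed.

(** Averaging over the three sheets with the characters of the group of cube roots of unity isolates
    [f0], [y f1] and [y^2 f2], each then bounded by [c]. [f0] and the cubes of the other two are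
    polynomials on the base, so the bounds pass to [q]. *)
Lemma hull_cubic_pullback_le3 q (y : C) f c : hull pol2 K q ->
  y ^+ 3 = cubed q -> pol2 f -> 0 <= c ->
  (forall v, cubic_pullback v -> cmod (f v) <= c) -> cmod (f (q.1, y)) <= 3 * c.
Proof.
move=> Kq yq Pf c0 fc.
have [f0 [f1 [f2 [P0 P1 P2 fE]]]] := pol2_cube_split Pf.
have lift v x : K v -> x ^+ 3 = cubed v -> cubic_pullback (v.1, x).
  move=> Kv xv; rewrite /cubic_pullback /= xv /cubed.
  have -> : (s * v.2 + v.1 ^+ 3 - v.1 ^+ 3) / s = v.2 by field.
  by case: v Kv {xv}.
have avg v x (a b : C) : K v -> x ^+ 3 = cubed v -> cmod a = 1 -> cmod b = 1 ->
    cmod (f (v.1, x) + a * f (v.1, cr * x) + b * f (v.1, cr ^+ 2 * x)) <= 3 * c.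
  move=> Kv xv a1 b1.
  have h1 : cmod (f (v.1, x)) <= c by apply: fc; exact: lift.
  have h2 : cmod (f (v.1, cr * x)) <= c.
    by apply/fc/lift => //; rewrite exprMn cr3 mul1r.
  have h3 : cmod (f (v.1, cr ^+ 2 * x)) <= c.
    by apply/fc/lift => //; rewrite exprMn -exprM mulnC exprM cr3 expr1n mul1r.
  apply: le_trans (cmodD _ _) _; rewrite [cmod (b * _)]cmodM b1 mul1r.
  have := cmodD (f (v.1, x)) (a * f (v.1, cr * x)).
  rewrite [cmod (a * _)]cmodM a1 mul1r; lra.
have cr3X (x : C) : (cr * x) ^+ 3 = x ^+ 3 by rewrite exprMn cr3 mul1r.
have cr23X (x : C) : (cr ^+ 2 * x) ^+ 3 = x ^+ 3.
  by rewrite exprMn -exprM mulnC exprM cr3 expr1n mul1r.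
have c3E : cr = - 1 - cr ^+ 2 by rewrite cr2E; ring.
have div3 (x : C) : cmod (3 * x) <= 3 * c -> cmod x <= c.
  have -> : 3 * x = rtoc 3 * x.
    have -> : 3 * x = x + x + x by ring.
    by apply: cplx_ext; rewrite !ReImE; ring.
  by rewrite cmodM cmod_rtoc ger0_norm // ler_pM2l.
have ccr : cmod cr = 1 by apply: cube_root_cmod; exact: cr3.
have ccr2 : cmod (cr ^+ 2) = 1 by rewrite cmodX ccr expr1n.
have b0 v x : K v -> x ^+ 3 = cubed v -> cmod (f0 (v.1, cubed v)) <= c.
  move=> Kv xv; apply: div3; rewrite -xv.
  have := avg _ _ 1 1 Kv xv (cmod1 _) (cmod1 _).
  rewrite !fE cr3X cr23X.
  move: (f0 _) (f1 _) (f2 _) => u0 u1 u2.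
  congr (cmod _ <= _).
  transitivity (3 * u0 + (1 + cr + cr ^+ 2) * (x * u1)
    + (1 + cr ^+ 2 + cr ^+ 3 * cr) * (x ^+ 2 * u2)); first by ring.
  by rewrite cr3 cr2E; ring.
(* The weights cancel the factors that [y] acquires on the other sheets; in [b2], those of [y^2]. *)
have b1 v x : K v -> x ^+ 3 = cubed v -> cmod (x * f1 (v.1, cubed v)) <= c.
  move=> Kv xv; apply: div3; rewrite -xv.
  have := avg _ _ (cr ^+ 2) cr Kv xv ccr2 ccr.
  rewrite !fE cr3X cr23X.
  move: (f0 _) (f1 _) (f2 _) => u0 u1 u2.
  congr (cmod _ <= _).
  transitivity ((1 + cr + cr ^+ 2) * u0 + (1 + cr ^+ 3 + cr ^+ 3) * (x * u1)
    + (1 + cr ^+ 3 * cr + cr ^+ 3 * cr ^+ 2) * (x ^+ 2 * u2)); first by ring.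
  by rewrite cr3 cr2E; ring.
have b2 v x : K v -> x ^+ 3 = cubed v -> cmod (x ^+ 2 * f2 (v.1, cubed v)) <= c.
  move=> Kv xv; apply: div3; rewrite -xv.
  have := avg _ _ cr (cr ^+ 2) Kv xv ccr ccr2.
  rewrite !fE cr3X cr23X.
  move: (f0 _) (f1 _) (f2 _) => u0 u1 u2.
  congr (cmod _ <= _).
  transitivity ((1 + cr + cr ^+ 2) * u0 + (1 + cr ^+ 2 + cr ^+ 3 * cr) * (x * u1)
    + (1 + cr ^+ 3 + cr ^+ 3 * cr ^+ 3) * (x ^+ 2 * u2)); first by ring.
  by rewrite cr3 cr2E; ring.
have root v : exists x : C, x ^+ 3 = cubed v.
  by exists (3.-root (cubed v)); rewrite rootCK.
have Pg g : pol2 g -> pol2 (fun v => g (v.1, cubed v)).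
  by move=> ?; apply: pol2_comp => //; [exact: pol2_fst | exact: pol2_cubed].
have q0 : cmod (f0 (q.1, cubed q)) <= c.
  by apply: (Kq _ _ (Pg _ P0)) => v Kv; have [x xv] := root v; exact: b0 Kv xv.
have q1 : cmod (y * f1 (q.1, cubed q)) <= c.
  rewrite -(@ler_pXn2r _ 3) ?nnegrE ?cmod_ge0 // -cmodX exprMn yq.
  apply: (Kq _ _ (pol2_mul pol2_cubed (pol2_exp 3 (Pg _ P1)))) => v Kv.
  have [x xv] := root v; rewrite -{1}xv -exprMn cmodX.
  by apply: lerXn2r; rewrite ?nnegrE ?cmod_ge0 // (b1 _ _ Kv xv).
have q2 : cmod (y ^+ 2 * f2 (q.1, cubed q)) <= c.
  rewrite -(@ler_pXn2r _ 3) ?nnegrE ?cmod_ge0 // -cmodX exprMn exprAC yq.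
  apply: (Kq _ _ (pol2_mul (pol2_exp 2 pol2_cubed) (pol2_exp 3 (Pg _ P2)))) => v Kv.
  have [x xv] := root v; rewrite -{1}xv exprAC -exprMn cmodX.
  by apply: lerXn2r; rewrite ?nnegrE ?cmod_ge0 // (b2 _ _ Kv xv).
rewrite fE yq; apply: le_trans (cmodD _ _) _.
have := cmodD (f0 (q.1, cubed q)) (y * f1 (q.1, cubed q)); lra.
Qed.

(* The factor 3 of the previous lemma disappears on passing to powers. *)
Lemma hull_cubic_pullback q (y : C) : hull pol2 K q ->
  y ^+ 3 = s * q.2 + q.1 ^+ 3 -> hull pol2 cubic_pullback (q.1, y).
Proof.
move=> Kq yq f c Pf fc.
have [c0|c0] := leP 0 c.
  apply: (@le_of_expr_le _ 1 3) => //; first exact: cmod_ge0.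
  move=> n; rewrite mul1r -cmodX.
  apply: (hull_cubic_pullback_le3 Kq yq (pol2_exp n Pf)); first exact: exprn_ge0.
  move=> v Kv; rewrite cmodX.
  by apply: lerXn2r; rewrite ?nnegrE ?cmod_ge0 // fc.
(* For negative [c] the pullback, and with it [K], is empty, so the constant 1 gives a contradiction
   at [q]. *)
have : cmod (1 : C) <= 0; last by rewrite cmod1 lt_geF.
apply: (Kq _ _ (pol2_cst 1)) => v Kv.
suff /fc : cubic_pullback (v.1, 3.-root (cubed v)).
  by move=> /(le_trans (cmod_ge0 _)); rewrite leNgt c0.
rewrite /cubic_pullback /= rootCK // /cubed.
have -> : (s * v.2 + v.1 ^+ 3 - v.1 ^+ 3) / s = v.2 by field.
by case: v Kv.
Qed.

End Pullback.

End TwoVariables.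

(** * The three planes *)

Section Planes.
Variable R : realType.
Local Notation C := (Cplx R).
Variable t : R.

Definition plane (e : C) : set (C * C) :=
  [set v | v.2 = e * (v.1 + rtoc t * Num.conj v.1)].

Definition quad (B : R) (v : C * C) : C :=
  rtoc (1 - t ^+ 2) * v.1 ^+ 2 + rtoc B * (v.1 * v.2) + v.2 ^+ 2.

Definition separates (B k0 k1 : R) := [/\ 0 < k0, k0 < k1,
  forall v, plane 1 v ->
    `|complex.Im (quad B v)| <= k0 * complex.Re (quad B v) &
  forall e v, e ^+ 3 = 1 -> e != 1 -> plane e v ->
    k1 * complex.Re (quad B v) <= `|complex.Im (quad B v)| ].

(** With [z = x + i y], the plane is [w = (1 + t) x + i (1 - t) y]; the last two brackets are the
    real parts of [z w] and [w^2]. *)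
Lemma quad_plane1 (B : R) v : plane 1 v -> exists x y : R,
  complex.Re (quad B v) = (1 - t ^+ 2) * (x ^+ 2 - y ^+ 2)
    + B * ((1 + t) * x ^+ 2 + (t - 1) * y ^+ 2)
    + ((1 + t) ^+ 2 * x ^+ 2 - (1 - t) ^+ 2 * y ^+ 2) /\
  complex.Im (quad B v) = (2 * (1 - t ^+ 2) + B) * 2 * (x * y).
Proof.
case: v => z w; rewrite /plane /= => ->; exists (complex.Re z), (complex.Im z).
by rewrite /quad /= !expr2 !ReImE; split; ring.
Qed.

(** Compared with [e = 1], [z w] is multiplied by [e = - 1/2 + b i] and [w^2] by [e^2], the
    conjugate of [e]. *)
Lemma quad_plane (B : R) e v : e ^+ 3 = 1 -> e != 1 -> plane e v ->
  exists x y b : R, b ^+ 2 = 3 / 4 /\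
  complex.Re (quad B v) = (1 - t ^+ 2) * (x ^+ 2 - y ^+ 2)
    - B * (((1 + t) * x ^+ 2 + (t - 1) * y ^+ 2) / 2 + b * (2 * (x * y)))
    - ((1 + t) ^+ 2 * x ^+ 2 - (1 - t) ^+ 2 * y ^+ 2) / 2
    + b * (2 * (1 - t ^+ 2) * (x * y)) /\
  complex.Im (quad B v) = (1 - t ^+ 2) * (x * y)
    - B * (x * y - b * ((1 + t) * x ^+ 2 + (t - 1) * y ^+ 2))
    - b * ((1 + t) ^+ 2 * x ^+ 2 - (1 - t) ^+ 2 * y ^+ 2).
Proof.
move=> e3 e1; have [ea eb] := cube_root_coords e3 e1.
have e2 : e ^+ 2 = Num.conj e.
  have eb2 := eb; rewrite expr2 in eb2.
  by apply: cplx_ext; rewrite !expr2 !ReImE ea; lra.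
case: v => z w; rewrite /plane /= => ->; exists (complex.Re z), (complex.Im z), (complex.Im e).
by split=> //; rewrite /quad /= exprMn e2 !expr2 !ReImE ea; split; field.
Qed.

Lemma le_norm_sqr (x y : R) : x ^+ 2 <= y ^+ 2 -> x <= `|y|.
Proof.
move=> xy; apply: le_trans (ler_norm x) _.
by rewrite -(@ler_pXn2r _ 2) ?nnegrE // !real_normK ?num_real.
Qed.

Lemma separates_small : 1 < t -> 4 * (t ^+ 2) ^+ 2 - 15 * t ^+ 2 + 12 < 0 ->
  exists k0 k1, separates 1 k0 k1.
Proof.
move=> t1 t4; have tp : 0 <= 1 + t by lra.
have tm : 0 <= t - 1 by lra.
 have T1 : 0 < t ^+ 2 - 1 by rewrite expr2; nra.
(* [s0] bounds the square of [Im / Re] on the plane [e = 1], where [Re = 3 a],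
   [Im = 2 (3 - 2 t^2) x y] and [a^2 >= 4 (t^2 - 1) x^2 y^2]. That [s0 < 1/3] is the hypothesis on
   [t]. *)
pose s0 := (3 - 2 * t ^+ 2) ^+ 2 / (9 * (t ^+ 2 - 1)).
have s00 : 0 <= s0 by rewrite divr_ge0 ?sqr_ge0 // mulr_ge0 // ltW.
have s0E : s0 * (9 * (t ^+ 2 - 1)) = (3 - 2 * t ^+ 2) ^+ 2.
  by rewrite divfK // gt_eqF // mulr_gt0.
have s01 : s0 < 1 / 3.
  by rewrite ltr_pdivrMr ?mulr_gt0 //; rewrite !expr2 in t4 *; lra.
(* The midpoint keeps [k0] positive even if [s0 = 0]. *)
pose s := (s0 + 1 / 3) / 2.
have sp : 0 < s by rewrite /s; lra.
exists (Num.sqrt s), (Num.sqrt (1 / 3)); split.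
- by rewrite sqrtr_gt0.
- by rewrite ltr_sqrt /s; lra.
- move=> v /(quad_plane1 1)[x [y [-> ->]]].
  set a := (1 + t) * x ^+ 2 + (t - 1) * y ^+ 2.
  have -> : (1 - t ^+ 2) * (x ^+ 2 - y ^+ 2) + 1 * a
      + ((1 + t) ^+ 2 * x ^+ 2 - (1 - t) ^+ 2 * y ^+ 2) = 3 * a.
    by rewrite /a; ring.
  have -> : (2 * (1 - t ^+ 2) + 1) * 2 * (x * y) = 2 * (3 - 2 * t ^+ 2) * (x * y).
    by ring.
  have a0 : 0 <= a.
    by apply: addr_ge0; apply: mulr_ge0; rewrite ?sqr_ge0.
  have axy : (t ^+ 2 - 1) * (2 * (x * y)) ^+ 2 <= a ^+ 2.
    have := sqr_ge0 ((1 + t) * x ^+ 2 - (t - 1) * y ^+ 2).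
    rewrite /a !expr2; lra.
  rewrite -(@ler_pXn2r _ 2) ?nnegrE ?mulr_ge0 ?sqrtr_ge0 //.
  rewrite real_normK ?num_real // !exprMn sqr_sqrtr ?(ltW sp) //.
  have h1 : s0 * (9 * ((t ^+ 2 - 1) * (2 * (x * y)) ^+ 2)) <= s * (9 * a ^+ 2).
    apply: ler_pM => //.
    - apply: mulr_ge0 => //; apply: mulr_ge0; [exact: ltW | exact: sqr_ge0].
    - by rewrite /s; lra.
    - by rewrite ler_pM2l.
  have h2 : s0 * (9 * ((t ^+ 2 - 1) * (2 * (x * y)) ^+ 2)) =
      2 ^+ 2 * (3 - 2 * t ^+ 2) ^+ 2 * (x ^+ 2 * y ^+ 2).
    by rewrite -s0E; ring.
  rewrite -h2; apply: le_trans h1 _; rewrite le_eqVlt; apply/orP; left.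
  by apply/eqP; ring.
- move=> e v e3 e1 /(quad_plane 1 e3 e1)[x [y [b [b2 [Re_v Im_v]]]]].
  have E : complex.Re (quad 1 v) = 2 * b * complex.Im (quad 1 v).
    rewrite Re_v Im_v.
    have -> : forall u w : R, 2 * b * ((1 - t ^+ 2) * (x * y)
        - 1 * (x * y - b * u) - b * w)
      = 2 * b * ((1 - t ^+ 2) * (x * y) - x * y) + 2 * b ^+ 2 * (u - w).
      by move=> u w; ring.
    by rewrite b2; field.
  apply: le_norm_sqr; rewrite exprMn sqr_sqrtr ?divr_ge0 // E !exprMn b2.
  by rewrite le_eqVlt; apply/orP; left; apply/eqP; field.
Qed.

Lemma separates_large : 1 < t -> 5 / 2 <= t ^+ 2 ->
  exists k0 k1, separates (2 * (t ^+ 2 - 1)) k0 k1.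
Proof.
move=> t1 T5; have T1 : 0 < t ^+ 2 - 1 by lra.
have tp : 0 <= 1 + t by lra.
have tm : 0 <= t - 1 by lra.
(* The slope comes from [3 Re <= 16 b Im] with [b^2 = 3/4]. On the plane [e = 1] the imaginary part
   vanishes, so any positive [k0] below [k1] will do. *)
pose k1 := Num.sqrt (3 / 64 : R).
have k1p : 0 < k1 by rewrite sqrtr_gt0.
exists (k1 / 2), k1; split; [lra | lra | |].
- move=> v /(quad_plane1 (2 * (t ^+ 2 - 1)))[x [y [-> ->]]].
  have -> : (2 * (1 - t ^+ 2) + 2 * (t ^+ 2 - 1)) * 2 * (x * y) = 0 by ring.
  rewrite normr0; apply: mulr_ge0; first lra.
  have -> : (1 - t ^+ 2) * (x ^+ 2 - y ^+ 2) + 2 * (t ^+ 2 - 1) * ((1 + t) * x ^+ 2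
     + (t - 1) * y ^+ 2) + ((1 + t) ^+ 2 * x ^+ 2 - (1 - t) ^+ 2 * y ^+ 2)
    = 2 * t ^+ 2 * ((1 + t) * x ^+ 2 + (t - 1) * y ^+ 2) by ring.
  apply: mulr_ge0; first by rewrite mulr_ge0 ?sqr_ge0.
  by apply: addr_ge0; apply: mulr_ge0; rewrite ?sqr_ge0.
- move=> e v e3 e1 /(quad_plane (2 * (t ^+ 2 - 1)) e3 e1).
  move=> [x [y [b [b2 [Re_v Im_v]]]]].
  (* [3 X] and [3 Y] are the coefficients of [x^2] and [y^2] in the form [16 b Im - 3 Re], whose
     cross term is [- 30 (t^2 - 1) b x y]. It is nonnegative if [X > 0] and
     [X Y >= 25 b^2 (t^2 - 1)^2], whence [75/4]. *)
  pose X := (1 + t) * (9 * t ^+ 2 - 5 / 2 * t - 27 / 2).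
  pose Y := (t - 1) * (9 * t ^+ 2 + 5 / 2 * t - 27 / 2).
  have t2 : 9 * t ^+ 2 - 27 / 2 > 5 / 2 * t.
    rewrite expr2 in T5 *; nra.
  have X0 : 0 < X by rewrite mulr_gt0 //; lra.
  have XY : 75 / 4 * (t ^+ 2 - 1) ^+ 2 <= X * Y.
    have -> : X * Y = (t ^+ 2 - 1) * ((9 * t ^+ 2 - 27 / 2) ^+ 2 - 25 / 4 * t ^+ 2).
      by rewrite /X /Y; field.
    rewrite [(t ^+ 2 - 1) ^+ 2]expr2 mulrCA ler_pM2l //.
    move: T5; move: (t ^+ 2) => T T5; rewrite expr2; nra.
  have E : 16 * b * complex.Im (quad (2 * (t ^+ 2 - 1)) v)
      - 3 * complex.Re (quad (2 * (t ^+ 2 - 1)) v)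
      = 3 * X * x ^+ 2 + 3 * Y * y ^+ 2 - 30 * (t ^+ 2 - 1) * b * (x * y).
    rewrite Re_v Im_v.
    have -> : forall B u w : R, 16 * b * ((1 - t ^+ 2) * (x * y)
        - B * (x * y - b * u) - b * w)
      = 16 * b * ((1 - t ^+ 2) * (x * y) - B * (x * y)) + 16 * b ^+ 2 * (B * u - w).
      by move=> B u w; ring.
    by rewrite b2 /X /Y; field.
  have : 0 <= 16 * b * complex.Im (quad (2 * (t ^+ 2 - 1)) v)
      - 3 * complex.Re (quad (2 * (t ^+ 2 - 1)) v).
    rewrite E -(pmulr_rge0 _ X0).
    have -> : X * (3 * X * x ^+ 2 + 3 * Y * y ^+ 2 - 30 * (t ^+ 2 - 1) * b * (x * y))
      = 3 * (X * x - 5 * (t ^+ 2 - 1) * b * y) ^+ 2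
        + 3 * y ^+ 2 * (X * Y - 25 * b ^+ 2 * (t ^+ 2 - 1) ^+ 2) by ring.
    rewrite b2; apply: addr_ge0; first by rewrite mulr_ge0 ?sqr_ge0.
    by apply: mulr_ge0; [rewrite mulr_ge0 ?sqr_ge0 | move: XY; clear; lra].
  move: (complex.Re _) (complex.Im _) => r i ri.
  have [r0|r0] := leP r 0.
    by apply: le_trans (normr_ge0 i); rewrite mulr_ge0_le0 // ltW.
  apply: le_norm_sqr; rewrite exprMn sqr_sqrtr //.
  have : (3 * r) ^+ 2 <= (16 * b * i) ^+ 2.
    by apply: lerXn2r; rewrite ?nnegrE; lra.
  rewrite !exprMn b2; lra.
Qed.

Lemma sqr_gt_threshold : 0 < t ->
  Num.sqrt (15 - Num.sqrt 33) / (2 * Num.sqrt 2) < t ->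
  exists a : R, [/\ a * a = 33, 5 < a, a < 6 & (15 - a) / 8 < t ^+ 2].
Proof.
move=> t0 ht; exists (Num.sqrt 33).
set a := Num.sqrt (33 : R) in ht *.
have aa : a * a = 33 by rewrite -expr2 sqr_sqrtr.
have ap : 0 <= a by exact: sqrtr_ge0.
have a5 : 5 < a by nra.
have a6 : a < 6 by nra.
split=> //.
have -> : (15 - a) / 8 = (Num.sqrt (15 - a) / (2 * Num.sqrt 2)) ^+ 2.
  rewrite expr_div_n exprMn !sqr_sqrtr //; last lra.
  by field.
by rewrite ltr_pXn2r ?nnegrE ?(ltW t0) // divr_ge0 ?mulr_ge0 ?sqrtr_ge0.
Qed.

Lemma gt1_of_threshold : 0 < t ->
  Num.sqrt (15 - Num.sqrt 33) / (2 * Num.sqrt 2) < t -> 1 < t.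
Proof.
by move=> t0 /(sqr_gt_threshold t0)[a [_ _ a6]]; rewrite expr2; nra.
Qed.

(** The roots of the polynomial in [t^2] are [(15 - a) / 8] and [(15 + a) / 8]; as [a > 5], the
    larger exceeds [5/2] and the two ranges overlap. *)
Lemma threshold_cases : 0 < t ->
  Num.sqrt (15 - Num.sqrt 33) / (2 * Num.sqrt 2) < t ->
  4 * (t ^+ 2) ^+ 2 - 15 * t ^+ 2 + 12 < 0 \/ 5 / 2 <= t ^+ 2.
Proof.
move=> t0 /(sqr_gt_threshold t0)[a [aa a5 a6 aT]].
have [|T5] := leP (5 / 2) (t ^+ 2); [by right|left].
move: aT T5; rewrite [(t ^+ 2) ^+ 2]expr2; move: (t ^+ 2) => T h2 h1.
have : 0 < (T - (15 - a) / 8) * ((15 + a) / 8 - T).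
  by apply: mulr_gt0; lra.
lra.
Qed.

Lemma exists_separates : 1 < t -> Num.sqrt (15 - Num.sqrt 33) / (2 * Num.sqrt 2) < t ->
  exists B k0 k1, separates B k0 k1 /\ 1 - t ^+ 2 - B ^+ 2 < 0.
Proof.
move=> t1; have T1 : 1 < t ^+ 2 by rewrite expr2; nra.
move=> /(threshold_cases (lt_trans ltr01 t1)).
move=> [/(separates_small t1)|/(separates_large t1)] [k0 [k1 S]].
  by exists 1, k0, k1; split => //; lra.
exists (2 * (t ^+ 2 - 1)), k0, k1; split => //.
by have := sqr_ge0 (2 * (t ^+ 2 - 1)); lra.
Qed.

End Planes.

(** * Hulls of subsets of the three planes *)

Section UnionOfPlanes.
Variables (R : realType) (t : R).
Local Notation C := (Cplx R).
Local Notation plane := (@plane R t).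
Local Notation quad := (@quad R t).

Lemma rtoc_eq0 (a : R) : (rtoc a == 0) = (a == 0).
Proof. by rewrite -cmod_eq0 cmod_rtoc normr_eq0. Qed.

(** On the plane the conjugate of [z] is the polynomial [(e^2 w - z) / t], and [hull_conj] carries
    this relation to the hull. *)
Lemma hull_in_plane e (K : set (C * C)) q : t != 0 -> e ^+ 3 = 1 ->
  bounded_on (@pol2 R) K -> (forall v, K v -> plane e v) ->
  hull (@pol2 R) K q -> plane e q.
Proof.
move=> t0 e3 bK Kp Kq; have rt0 : rtoc t != 0 by rewrite rtoc_eq0.
pose g (v : C * C) := (e ^+ 2 * v.2 + - 1 * v.1) * (rtoc t)^-1.
have Pg : pol2 g.
  by repeat (exact: pol2_cst || exact: pol2_fst || exact: pol2_snd ||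
             apply: pol2_mul || apply: pol2_add).
have := hull_conj (pol2_alg R) bK (@pol2_fst R) Pg Kq.
have h v : K v -> g v = Num.conj v.1.
  move=> /Kp; rewrite /plane /= => vE.
  have -> : g v = (e ^+ 2 * v.2 - v.1) / rtoc t by rewrite /g mulN1r.
  by rewrite vE mulrA -exprSr e3 mul1r; field.
move=> /(_ h); rewrite /plane /= => <-; rewrite /g.
have -> : q.1 + rtoc t * ((e ^+ 2 * q.2 + -1 * q.1) / rtoc t) = e ^+ 2 * q.2.
  by field.
by rewrite mulrA -exprS e3 mul1r.
Qed.

(** As [e^2] is the inverse of the cube root of unity [e], this takes the plane of [e] to that of
    1. *)
Let twist (e : C) (v : C * C) : C * C := (v.1, e ^+ 2 * v.2).

Lemma plane_twist e e' v : plane e' v -> plane (e ^+ 2 * e') (twist e v).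
Proof. by rewrite /plane /= => ->; rewrite mulrA. Qed.

Variables (B k0 k1 : R).
Hypotheses (t1 : 1 < t) (sep : separates t B k0 k1).
Hypothesis Bt : 1 - t ^+ 2 - B ^+ 2 < 0.

Lemma pol2_quad_twist e : pol2 (fun v => quad B (twist e v)).
Proof.
apply: pol2_add; first apply: pol2_add.
- exact/(pol2_mul (pol2_cst _))/pol2_exp/pol2_fst.
- apply/(pol2_mul (pol2_cst _))/(pol2_mul (@pol2_fst R)).
  exact/(pol2_mul (pol2_cst _))/pol2_snd.
- exact/pol2_exp/(pol2_mul (pol2_cst _))/pol2_snd.
Qed.

(** The difference of the equations, divided by [e - e'], is [w (b (e + e') z + w) = 0]. The first
    factor leaves [a z^2 = 0]; the second, through [e e' (e + e') = - 1], leaves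
    [(a - b^2) z^2 = 0]. *)
Lemma quad_twist_eq0 e e' v : e ^+ 3 = 1 -> e' ^+ 3 = 1 -> e != e' ->
  quad B (twist e v) = 0 -> quad B (twist e' v) = 0 -> v.1 = 0 /\ v.2 = 0.
Proof.
move=> e3 e'3 ee'; rewrite /quad /=; move: v.1 v.2 => z w h1 h2.
have [e0 e'0] : e != 0 /\ e' != 0.
  by split; apply/eqP => h; [move: e3 | move: e'3];
    rewrite h expr0n /= => /esym/eqP; rewrite oner_eq0.
have d0 : e - e' != 0 by rewrite subr_eq0.
have s0 : e ^+ 2 + e * e' + e' ^+ 2 = 0.
  apply: (mulfI d0); rewrite mulr0.
  transitivity (e ^+ 3 - e' ^+ 3); [by ring | by rewrite e3 e'3 subrr].
pose b : C := rtoc B; pose a : C := rtoc (1 - t ^+ 2).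
have h1' : a * z ^+ 2 + b * e ^+ 2 * (z * w) + e * w ^+ 2 = 0.
  rewrite -[RHS]h1 exprMn -exprM (exprD e 3 1) e3 mul1r expr1 /a /b; ring.
have h2' : a * z ^+ 2 + b * e' ^+ 2 * (z * w) + e' * w ^+ 2 = 0.
  rewrite -[RHS]h2 exprMn -exprM (exprD e' 3 1) e'3 mul1r expr1 /a /b; ring.
have p1 : e * e' * (e + e') = - 1.
  have -> : e * e' * (e + e') = e * (e ^+ 2 + e * e' + e' ^+ 2) - e ^+ 3 by ring.
  by rewrite s0 e3 mulr0 sub0r.
have hw : w * (b * (e + e') * z + w) = 0.
  apply: (mulfI d0); rewrite mulr0 -(subrr 0) -{1}h1' -h2'; ring.
have ab : a - b ^+ 2 != 0.
  have -> : a - b ^+ 2 = rtoc (1 - t ^+ 2 - B ^+ 2).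
    by apply: cplx_ext; rewrite /a /b !expr2 !ReImE; ring.
  by rewrite rtoc_eq0 lt_eqF.
have a0 : a != 0 by rewrite /a rtoc_eq0 subr_eq0 eq_sym gt_eqF // exprn_egt1.
move/eqP: hw; rewrite mulf_eq0 => /orP[/eqP w0|/eqP hw].
  move: h1'; rewrite w0 => /eqP.
  rewrite mulr0 mulr0 expr0n /= mulr0 !addr0 mulf_eq0 (negbTE a0) /=.
  by rewrite expf_eq0 /= => /eqP.
have wE : w = - (b * (e + e') * z).
  by apply/eqP; rewrite -addr_eq0 addrC hw.
have : (a - b ^+ 2) * z ^+ 2 = 0.
  rewrite -h1' wE.
  transitivity (a * z ^+ 2 + b ^+ 2 * (e * e' * (e + e')) * z ^+ 2).
    by rewrite p1; ring.
  by ring.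
move/eqP; rewrite mulf_eq0 (negbTE ab) expf_eq0 /= => /eqP z0.
by rewrite wE z0 mulr0 oppr0.
Qed.

Variables (K : set (C * C)) (r : R).
Hypothesis K_le : forall v, K v -> cmod v.1 <= r.
Hypothesis K_planes : forall v, K v -> exists2 e, e ^+ 3 = 1 & plane e v.

Let sub (S : C -> Prop) : set (C * C) :=
  [set v | K v /\ exists2 e, S e & e ^+ 3 = 1 /\ plane e v].

Lemma planes_bounded (S : C -> Prop) : bounded_on (@pol2 R) (sub S).
Proof.
apply: (@pol2_bounded _ _ r ((1 + t) * r)) => v [Kv [e _ [e3 ve]]].
split; first exact: K_le.
rewrite ve cmodM (cube_root_cmod e3) mul1r; apply: le_trans (cmodD _ _) _.
rewrite cmodM cmod_rtoc.
have -> : cmod (Num.conj v.1) = cmod v.1.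
  apply/eqP; rewrite -(@eqrXn2 _ 2) ?cmod_ge0 // !cmod_sqr !ReImE.
  by rewrite sqrrN.
have := K_le Kv; have := t1 => h1 h2.
rewrite ger0_norm; nra.
Qed.

(** By [kallin] for the rotated [quad], [q] lies in the hull of the part on the plane of [e], which
    stays in that plane, or of the rest. Kallin's lemma is silent where the polynomial vanishes, so
    that case is kept as an alternative. *)
Lemma remove_plane S e q : e ^+ 3 = 1 -> ~ plane e q ->
  hull (@pol2 R) (sub S) q ->
  hull (@pol2 R) (sub (fun e' => S e' /\ (e' <> e \/ quad B (twist e q) = 0))) q.
Proof.
move=> e3 nq Sq; have [h0|h0] := eqVneq (quad B (twist e q)) 0.
  apply: hullS Sq => v [Kv [e' Se' e'v]]; split=> //; exists e' => //.
  by split=> //; right.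
have [k00 k01 sep1 sep2] := sep.
pose K0 : set (C * C) := [set v | sub S v /\ plane e v]%classic.
pose K1 := sub (fun e' => S e' /\ e' <> e).
have := @kallin R _ _ _ (pol2_alg R) (planes_bounded S) K0 K1 k0 k1
  _ q (pol2_quad_twist e) k00 k01 _ Sq h0.
case.
- move=> v [Kv [e' Se' [e'3 e'v]]].
  have [ee'|/eqP ee'] := eqVneq e' e.
    left; split; first by split; [split=> //; exists e' | rewrite -ee'].
    apply: sep1; have := plane_twist e e'v.
    by rewrite ee' -exprSr e3.
  right; split; first by split=> //; exists e'.
  apply: sep2 (plane_twist e e'v).
    by rewrite exprMn e'3 mulr1 exprAC e3 expr1n.
  apply/eqP => h; apply: ee'.
  by rewrite -[RHS]mulr1 -h mulrA -exprS e3 mul1r.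
- move=> K0q; case: nq; apply: (@hull_in_plane e K0) => //.
  + by rewrite gt_eqF // (lt_trans _ t1).
  + by apply: bounded_onS (planes_bounded S) => v [].
  + by move=> v [].
- apply: hullS => v [Kv [e' [Se' ee'] e'v]]; split=> //; exists e' => //.
  by split=> //; left.
Qed.

Lemma hull_planes q : hull (@pol2 R) K q -> exists2 e, e ^+ 3 = 1 & plane e q.
Proof.
move=> Kq; apply: contrapT => nq.
have np e : e ^+ 3 = 1 -> ~ plane e q by move=> e3 h; apply: nq; exists e.
have c23 : (cr R ^+ 2) ^+ 3 = 1 by rewrite exprAC cr3 expr1n.
have h0 : hull (@pol2 R) (sub (fun=> True)) q.
  apply: hullS Kq => v Kv; split=> //; have [e e3 ve] := K_planes Kv.
  by exists e.
have := remove_plane c23 (np _ c23)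
  (remove_plane (cr3 R) (np _ (cr3 R))
  (remove_plane (expr1n _ 3) (np _ (expr1n _ 3)) h0)).
(* An index surviving all three removals makes the rotated [quad] vanish at [q]. Two such indices
   would put [q] at the origin, which is on every plane, so at most one plane remains. *)
set S := (fun e => _) => Sq.
have S0 e : e ^+ 3 = 1 -> S e -> quad B (twist e q) = 0.
  move=> e3 [[[_ h1] h2] h3].
  by have [ee|ee|ee] := cube_rootP e3; [case: h1|case: h2|case: h3]; rewrite ee.
have S1 e e' : e ^+ 3 = 1 -> e' ^+ 3 = 1 -> S e -> S e' -> e = e'.
  move=> e3 e'3 Se Se'; apply/eqP/negPn/negP => ee'.
  have [q1 q2] := quad_twist_eq0 e3 e'3 ee' (S0 _ e3 Se) (S0 _ e'3 Se').
  apply: (np 1 (expr1n _ 3)); rewrite /plane /= q1 q2 rmorph0.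
  by rewrite mulr0 addr0 mulr0.
have t0 : t != 0 by rewrite gt_eqF // (lt_trans _ t1).
have [[e0 [e03 Se0]]|ne] := pselect (exists e, e ^+ 3 = 1 /\ S e).
  apply: (np e0 e03); apply: (hull_in_plane t0 e03 (planes_bounded S) _ Sq).
  by move=> v [_ [e Se [e3 ve]]]; rewrite -(S1 _ _ e3 e03 Se Se0).
apply: (np 1 (expr1n _ 3)).
apply: hull_in_plane t0 (expr1n _ 3) (planes_bounded S) _ Sq.
by move=> v [_ [e Se [e3 ve]]]; case: ne; exists e.
Qed.

End UnionOfPlanes.

(** * Balls and the surface *)

Section Balls.
Variable R : realType.
Local Notation C := (Cplx R).

Lemma enorm_ge0 n (v : 'rV[C]_n) : 0 <= enorm v.
Proof. exact: sqrtr_ge0. Qed.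

Lemma enorm2_sqr (v : 'rV[C]_2) :
  enorm v ^+ 2 = cmod (v ord0 ord0) ^+ 2 + cmod (v ord0 ord_max) ^+ 2.
Proof.
rewrite sqr_sqrtr; last by apply: sumr_ge0 => i _; exact: sqr_ge0.
rewrite !big_ord_recl big_ord0 addr0; congr (_ + cmod (v _ _) ^+ 2).
exact: val_inj.
Qed.

Lemma cplx_norm (z : C) : `|z| = rtoc (cmod z).
Proof. by case: z. Qed.

Lemma rtoc_lt (a b : R) : (rtoc a < rtoc b) = (a < b).
Proof. by rewrite /rtoc ltcR. Qed.

Lemma pos_rtoc (e : C) : 0 < e -> exists2 a, 0 < a & e = rtoc a.
Proof.
case: e => a b; rewrite ltcE /= => /andP[/eqP b0 a0].
by exists a => //; rewrite b0.
Qed.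

Lemma closure_oball_le (r : R) (v : 'rV[C]_2) : 0 < r ->
  closure (oball 0 r) v -> enorm v <= r.
Proof.
move=> r0 vr; rewrite -(@ler_pXn2r _ 2) ?nnegrE ?enorm_ge0 ?(ltW r0) //.
apply/ler_addgt0Pr => e e0.
(* Raising two moduli, each at most [r], by [d <= 1] increases the sum of squares by at most
   [d (4 r + 2)]. *)
pose d := Num.min 1 (e / (4 * r + 2)).
have r4 : 0 < 4 * r + 2 by lra.
have d0 : 0 < d by rewrite lt_min ltr01 divr_gt0.
have d1 : d <= 1 by rewrite ge_min lexx.
have de : d * (4 * r + 2) <= e.
  by rewrite -ler_pdivlMr // ge_min lexx orbT.
have : nbhs v (ball v (rtoc d)).
  by apply: nbhsx_ballx; rewrite -[0]/(rtoc 0) rtoc_lt.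
move=> /vr[y []]; rewrite /oball /= subr0 => yr [_ vy].
have le i : cmod (v ord0 i) <= cmod (y ord0 i) + d.
  have : ball (v ord0 i) (rtoc d) (y ord0 i) by exact: vy.
  rewrite /ball /= cplx_norm rtoc_lt => h.
  have := cmodD (v ord0 i - y ord0 i) (y ord0 i); rewrite subrK; lra.
have y2 : enorm y ^+ 2 <= r ^+ 2.
  by apply: lerXn2r; rewrite ?nnegrE ?enorm_ge0 ?(ltW r0) ?(ltW yr).
move: y2; rewrite !enorm2_sqr; have := le ord0; have := le ord_max.
have := cmod_ge0 (v ord0 ord0); have := cmod_ge0 (v ord0 ord_max).
have := cmod_ge0 (y ord0 ord0); have := cmod_ge0 (y ord0 ord_max).
move: (cmod (v ord0 ord0)) (cmod (v ord0 ord_max)) => a b.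
move: (cmod (y ord0 ord0)) (cmod (y ord0 ord_max)) => a' b'.
rewrite !expr2 => b'0 a'0 b0 a0 hb ha h.
have ar : a' <= r by nra.
have br : b' <= r by nra.
have : a * a <= (a' + d) * (a' + d) by rewrite ler_pM.
have : b * b <= (b' + d) * (b' + d) by rewrite ler_pM.
have : d * a' <= d * r by rewrite ler_pM2l.
have : d * b' <= d * r by rewrite ler_pM2l.
have : d * d <= d by rewrite ler_piMr // ltW.
lra.
Qed.

Lemma le_closure_oball (r : R) (v : 'rV[C]_2) : 0 < r ->
  enorm v <= r -> closure (oball 0 r) v.
Proof.
move=> r0 vr A /nbhs_ballP[e /= /pos_rtoc[a a0 ->] vA].
pose d := Num.min 1 (a / (2 * r)).
have d0 : 0 < d by rewrite lt_min ltr01 divr_gt0 ?mulr_gt0.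
have d1 : d <= 1 by rewrite ge_min lexx.
have da : d * (2 * r) <= a by rewrite -ler_pdivlMr ?mulr_gt0 // ge_min lexx orbT.
have v2 : enorm v ^+ 2 <= r ^+ 2.
  by apply: lerXn2r; rewrite ?nnegrE ?enorm_ge0 ?(ltW r0).
exists (rtoc (1 - d) *: v); split.
  rewrite /oball /= subr0 -(@ltr_pXn2r _ 2) ?nnegrE ?enorm_ge0 ?(ltW r0) //.
  rewrite enorm2_sqr !mxE !cmodM !cmod_rtoc !exprMn -mulrDr -enorm2_sqr.
  rewrite real_normK ?num_real //.
  have r2 : 0 < r ^+ 2 by exact: exprn_gt0.
  apply: le_lt_trans (ler_wpM2l (sqr_ge0 _) v2) _.
  by rewrite gtr_pMl //; rewrite expr2; nra.
apply: vA; split=> [|i j]; first by rewrite -[0]/(rtoc 0) rtoc_lt.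
rewrite ord1 /ball /= !mxE cplx_norm rtoc_lt.
have -> : v ord0 j - rtoc (1 - d) * v ord0 j = rtoc d * v ord0 j.
  by apply: cplx_ext; rewrite !ReImE; ring.
rewrite cmodM cmod_rtoc gtr0_norm //.
have vj : cmod (v ord0 j) <= r.
  rewrite -(@ler_pXn2r _ 2) ?nnegrE ?cmod_ge0 ?(ltW r0) //.
  apply: le_trans v2; rewrite enorm2_sqr.
  case: j => -[|[|//]] hj.
    have -> : Ordinal hj = ord0 by exact: val_inj.
    by rewrite lerDl sqr_ge0.
  have -> : Ordinal hj = ord_max by exact: val_inj.
  by rewrite lerDr sqr_ge0.
have : d * cmod (v ord0 j) <= d * r by rewrite ler_pM2l.
have : 0 < d * r by exact: mulr_gt0.
lra.
Qed.

(** The test function is the Hermitian product with [q]: Cauchy-Schwarz bounds it by [|q| r] on [K],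
    and its value at [q] is [|q|^2]. *)
Lemma hull_ball (K : set 'rV[C]_2) (r : R) (q : 'rV[C]_2) : 0 < r ->
  (forall v, K v -> enorm v <= r) ->
  hull (@pol2 R) (coords K) (q ord0 ord0, q ord0 ord_max) -> enorm q <= r.
Proof.
move=> r0 Kr Kq.
pose a := q ord0 ord0; pose b := q ord0 ord_max.
pose g (v : C * C) := Num.conj a * v.1 + Num.conj b * v.2.
have Pg : pol2 g.
  apply: pol2_add; apply: pol2_mul; try exact: pol2_cst.
    exact: pol2_fst.
  exact: pol2_snd.
have cj (z : C) : cmod (Num.conj z) = cmod z.
  apply/eqP; rewrite -(@eqrXn2 _ 2) ?cmod_ge0 // !cmod_sqr !ReImE.
  by rewrite sqrrN.
have : cmod (g (a, b)) <= enorm q * r.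
  apply: (Kq _ _ Pg) => _ [x Kx ->]; rewrite /g /=.
  apply: le_trans (cmodD _ _) _; rewrite !cmodM !cj.
  rewrite -(@ler_pXn2r _ 2) ?nnegrE ?addr_ge0 ?mulr_ge0 ?cmod_ge0 ?enorm_ge0 ?(ltW r0) //.
  have x2 : enorm x ^+ 2 <= r ^+ 2.
    by apply: lerXn2r; rewrite ?nnegrE ?enorm_ge0 ?(ltW r0) // Kr.
  rewrite exprMn; apply: le_trans (ler_wpM2l (sqr_ge0 _) x2).
  rewrite !enorm2_sqr -/a -/b.
  move: (cmod a) (cmod b) (cmod (x _ _)) (cmod (x _ _)) => c d c' d'.
  by have := sqr_ge0 (c * c' - d * d'); rewrite !expr2; lra.
have -> : g (a, b) = rtoc (enorm q ^+ 2).
  rewrite /g /= mulrC [Num.conj b * b]mulrC !cmod_mul_conj enorm2_sqr.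
  by apply: cplx_ext; rewrite !ReImE; ring.
rewrite cmod_rtoc ger0_norm ?sqr_ge0 // expr2.
have [q0|q0] := eqVneq (enorm q) 0; first by rewrite q0 => _; exact: ltW.
by rewrite ler_pM2l // lt_def q0 enorm_ge0.
Qed.

End Balls.

(** * Passing the equation of the surface to the hull *)

Section Surface.
Variables (R : realType).
Local Notation C := (Cplx R).

Lemma cubicE (t : R) (z y : C) :
  rtoc (3 * t) * cubic t z y + z ^+ 3 = (z + rtoc t * y) ^+ 3.
Proof.
rewrite /cubic.
have -> : rtoc (t ^+ 2 / 3) = rtoc (1 / 3) * rtoc t ^+ 2.
  by apply: cplx_ext; rewrite !expr2 !ReImE; field.
have -> : rtoc (3 * t) = 3 * rtoc t.
  have -> : 3 * rtoc t = rtoc t + rtoc t + rtoc t by ring.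
  by apply: cplx_ext; rewrite !ReImE; ring.
have h : 3 * rtoc (1 / 3 : R) = 1.
  have -> : 3 * rtoc (1 / 3 : R) = rtoc (1 / 3) + rtoc (1 / 3) + rtoc (1 / 3).
    by ring.
  by apply: cplx_ext; rewrite !ReImE; field.
transitivity (z ^+ 3 + 3 * z ^+ 2 * (rtoc t * y) + 3 * z * (rtoc t * y) ^+ 2
  + (3 * rtoc (1 / 3)) * (rtoc t * y) ^+ 3); first by ring.
by rewrite h; ring.
Qed.

Lemma surf_cubeP (t : R) (v : 'rV[C]_2) : t != 0 -> surf t v <->
  rtoc (3 * t) * v ord0 ord_max + v ord0 ord0 ^+ 3
    = (v ord0 ord0 + rtoc t * Num.conj (v ord0 ord0)) ^+ 3.
Proof.
move=> t0; rewrite -cubicE /surf /=; split=> [->//|/addIr/mulfI -> //].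
by rewrite rtoc_eq0 mulf_neq0.
Qed.

(** The closed ball is handled by [hull_ball], so only the equation of the surface has to pass to
    the hull. *)
Lemma locally_poly_convex_surf (t : R) : t != 0 ->
  (forall (K : set (C * C)) r q,
     (forall v, K v -> cmod v.1 <= r /\ cmod v.2 <= r) ->
     (forall v, K v -> rtoc (3 * t) * v.2 + v.1 ^+ 3
                       = (v.1 + rtoc t * Num.conj v.1) ^+ 3) ->
     hull (@pol2 R) K q ->
     rtoc (3 * t) * q.2 + q.1 ^+ 3 = (q.1 + rtoc t * Num.conj q.1) ^+ 3) ->
  locally_poly_convex (surf t) 0.
Proof.
move=> t0 H; exists 1 => //; apply/seteqP; split=> [q Kq|v Kv p].
  have Kle v : (surf t `&` closure (oball 0 1))%classic v -> enorm v <= 1.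
    by move=> [_]; exact: closure_oball_le.
  have Cq := poly_hull_coords Kq; split; last first.
    by apply: le_closure_oball => //; exact: hull_ball Kle Cq.
  apply/(surf_cubeP _ t0); apply: (H _ 1 _ _ _ Cq) => _ [x Kx ->] /=.
    have := Kle _ Kx; rewrite -(@ler_pXn2r _ 2) ?nnegrE ?enorm_ge0 //.
    rewrite enorm2_sqr expr1n => h.
    split; rewrite -(@ler_pXn2r _ 2) ?nnegrE ?cmod_ge0 // expr1n;
      apply: le_trans h; [rewrite lerDl | rewrite lerDr]; exact: sqr_ge0.
  by apply/(surf_cubeP _ t0); exact: Kx.1.
by apply: ereal_sup_ubound; exists v.
Qed.

Lemma hull_cube_graph (t r : R) (K : set (C * C)) q : 1 < t ->
  Num.sqrt (15 - Num.sqrt 33) / (2 * Num.sqrt 2) < t ->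
  (forall v, K v -> cmod v.1 <= r /\ cmod v.2 <= r) ->
  (forall v, K v -> rtoc (3 * t) * v.2 + v.1 ^+ 3
                    = (v.1 + rtoc t * Num.conj v.1) ^+ 3) ->
  hull (@pol2 R) K q ->
  rtoc (3 * t) * q.2 + q.1 ^+ 3 = (q.1 + rtoc t * Num.conj q.1) ^+ 3.
Proof.
move=> t1 ht Kr KS Kq.
have [B [k0 [k1 [sep Bt]]]] := exists_separates t1 ht.
have s0 : rtoc (3 * t) != 0 by rewrite rtoc_eq0 gt_eqF // mulr_gt0 // (lt_trans _ t1).
set u := LHS; have yu : (3.-root u) ^+ 3 = u by rewrite rootCK.
have Kq' := hull_cubic_pullback s0 Kq yu.
have Kle v : cubic_pullback (rtoc (3 * t)) K v -> cmod v.1 <= r by move=> /Kr[].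
have Kpl v : cubic_pullback (rtoc (3 * t)) K v ->
    exists2 e, e ^+ 3 = 1 & plane t e v.
  move=> /KS /=; rewrite mulrCA divff // mulr1 subrK => vE.
  have [X0|X0] := eqVneq (v.1 + rtoc t * Num.conj v.1) 0.
    exists 1; first exact: expr1n.
    rewrite /plane /= X0 mulr0; apply/eqP.
    have : v.2 ^+ 3 == 0 by rewrite vE X0 expr0n.
    by rewrite expf_eq0.
  exists (v.2 / (v.1 + rtoc t * Num.conj v.1)).
    by rewrite expr_div_n vE divff // expf_neq0.
  by rewrite /plane /= divfK.
have [e e3] := hull_planes t1 sep Bt Kle Kpl Kq'.
by rewrite /plane /= => h; rewrite -yu h exprMn e3 mul1r.
Qed.

Lemma hull_real_cube (r : R) (K : set (C * C)) q :
  (forall v, K v -> cmod v.1 <= r /\ cmod v.2 <= r) ->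
  (forall v, K v -> rtoc (3 * 1) * v.2 + v.1 ^+ 3
                    = (v.1 + rtoc 1 * Num.conj v.1) ^+ 3) ->
  hull (@pol2 R) K q ->
  rtoc (3 * 1) * q.2 + q.1 ^+ 3 = (q.1 + rtoc 1 * Num.conj q.1) ^+ 3.
Proof.
move=> Kr KS Kq.
have bK : bounded_on (@pol2 R) K by exact: pol2_bounded Kr.
pose u (v : C * C) : C := rtoc (3 * 1) * v.2 + v.1 ^+ 3.
have Pu : pol2 u.
  apply: pol2_add; first exact/(pol2_mul (pol2_cst _))/pol2_snd.
  exact/pol2_exp/pol2_fst.
have realE (z : C) : (z + rtoc 1 * Num.conj z) ^+ 3 = rtoc ((2 * complex.Re z) ^+ 3).
  have -> : z + rtoc 1 * Num.conj z = rtoc (2 * complex.Re z).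
    by apply: cplx_ext; rewrite !ReImE; ring.
  by apply: cplx_ext; rewrite !exprS !expr0 !ReImE; ring.
have uK v : K v -> u v = rtoc ((2 * complex.Re v.1) ^+ 3).
  by move=> Kv; rewrite -realE -KS.
have PA := pol2_alg R.
have Pm (c : C) f : pol2 f -> pol2 (fun v => c * f v).
  by move=> Pf; apply: pol2_mul => //; exact: pol2_cst.
(* [hull_Re] is applied to [i u] and [- i u]. *)
have Im_u : complex.Im (u q) = 0.
  have h (s : R) : - (s * complex.Im (u q)) <= 0.
    have := @hull_Re _ _ _ _ PA bK _ 0 q (Pm (Complex 0 s) _ Pu) Kq.
    rewrite ReImE /= mul0r sub0r; apply => x Kx.
    by rewrite uK // !ReImE /= !(mul0r, mulr0, subr0).
  by have := h 1; have := h (-1); lra.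
pose X := 2 * complex.Re q.1; pose c := complex.Re (u q).
suff cX : c = X ^+ 3.
  rewrite realE; change (u q = rtoc (X ^+ 3)).
  by apply: cplx_ext; [exact: cX | exact: Im_u].
(* The sign [s] treats both strict inequalities at once. The aim is a polynomial [F] with
   [Re F >= 0] on [K] and [Re (F q) = - h < 0]. *)
have key (s : R) : s * s = 1 -> ~ (s * X ^+ 3 < s * c).
  move=> ss; rewrite -subr_gt0; set D := s * c - _ => D0.
  have s3 : s ^+ 3 = s by rewrite !exprS expr0 mulr1 ss mulr1.
  (* For [0 < h <= 1] the increment [(Y + h)^3 - Y^3] is at most [h N]; the [h] below makes
     [h N < D]. *)
  pose Y := s * X; pose N := 3 * Y ^+ 2 + 3 * `|Y| + 1.
  have Y3 : Y ^+ 3 = s * X ^+ 3 by rewrite /Y exprMn s3.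
  have N1 : 1 <= N.
    by rewrite lerDr addr_ge0 // mulr_ge0 ?sqr_ge0.
  have DN : 0 < D + N by rewrite addr_gt0 // (lt_le_trans ltr01).
  pose h := D / (D + N).
  have h0 : 0 < h by exact: divr_gt0.
  have h1 : h <= 1 by rewrite ler_pdivrMr // mul1r lerDl (le_trans ler01).
  have hN : h * N < D.
    rewrite mulrAC ltr_pdivrMr // ltr_pM2l // ltrDr //.
  have Yh : (Y + h) ^+ 3 < s * c.
    have -> : (Y + h) ^+ 3 = Y ^+ 3 + h * (3 * Y ^+ 2 + 3 * Y * h + h ^+ 2) by ring.
    rewrite Y3 -ltrBrDl -/D; apply: le_lt_trans hN; rewrite ler_pM2l //.
    rewrite /N lerD ?exprn_ile1 ?(ltW h0) // lerD // -mulrA ler_pM2l //.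
    apply: le_trans (ler_norm _) _; rewrite normrM (gtr0_norm h0).
    by rewrite ler_piMr.
  pose d := s * c - (Y + h) ^+ 3.
  have d0 : 0 < d by rewrite subr_gt0.
  (* Where [s x < Y + h], with [x = 2 Re v.1], [u v] differs from [c] by at least [d]; the square
     times [M] is then at least [2 |r| + |Y| + 1], which offsets [s x - (Y + h)]. *)
  pose M := (2 * `|r| + `|Y| + 1) / d ^+ 2.
  have M0 : 0 <= M by rewrite divr_ge0 ?sqr_ge0 // !addr_ge0 ?mulr_ge0.
  pose F v : C := rtoc (2 * s) * v.1 + rtoc (- (Y + h))
    + rtoc M * (rtoc s * u v + rtoc (- (s * c))) ^+ 2.
  have PF : pol2 F.
    apply: pol2_add; first apply: pol2_add.
    - exact/Pm/pol2_fst.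
    - exact: pol2_cst.
    - apply/Pm/pol2_exp/pol2_add; last exact: pol2_cst.
      exact: Pm.
  have ReF (v : C * C) (b : R) : u v = rtoc b ->
      complex.Re (F v) = s * (2 * complex.Re v.1) - (Y + h) + M * (s * b - s * c) ^+ 2.
    by move=> uv; rewrite /F uv !expr2 !ReImE; ring.
  have uq : u q = rtoc c by apply: cplx_ext; rewrite // Im_u.
  have := @hull_Re _ _ _ _ PA bK _ 0 q (Pm (- 1) _ PF) Kq.
  have opp v : complex.Re (- 1 * F v) = - complex.Re (F v).
    by rewrite mulN1r Re_opp.
  rewrite opp (ReF _ _ uq) subrr expr0n /= mulr0 addr0 -/X -/Y.
  have -> : - (Y - (Y + h)) = h by ring.
  move=> H; have : h <= 0; last by rewrite leNgt h0.
  apply: H => v Kv; rewrite opp (ReF _ _ (uK v Kv)) oppr_le0.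
  set x := 2 * complex.Re v.1; rewrite -{2}s3 -exprMn.
  have xr : - (2 * `|r|) <= s * x.
    have sn : `|s| = 1.
      by apply/eqP; rewrite -(@pexpr_eq1 _ _ 2) // expr2 -normrM ss normr1.
    have := ler_norm (- (s * x)); rewrite normrN normrM sn mul1r /x normrM.
    have := Re_le_cmod v.1; have := (Kr v Kv).1; have := ler_norm r.
    rewrite (@ger0_norm _ 2) //; lra.
  have [xY|xY] := leP (Y + h) (s * x).
    by rewrite addr_ge0 ?subr_ge0 // mulr_ge0 ?sqr_ge0.
  have x3 : d <= s * c - (s * x) ^+ 3.
    rewrite lerD2l lerN2; move: xY; move: (s * x) (Y + h) => a b ab.
    have : 0 <= (b - a) * (b ^+ 2 + a * b + a ^+ 2).
      apply: mulr_ge0; first by rewrite subr_ge0 ltW.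
      by have := sqr_ge0 (a + b); have := sqr_ge0 a; have := sqr_ge0 b;
        rewrite !expr2; lra.
    by rewrite !exprS expr0; lra.
  have : M * d ^+ 2 <= M * ((s * x) ^+ 3 - s * c) ^+ 2.
    rewrite ler_wpM2l // -[leRHS]sqrrN opprB.
    by apply: lerXn2r; rewrite ?nnegrE ?(ltW d0) // (le_trans (ltW d0)).
  rewrite divfK ?gt_eqF ?exprn_gt0 //; have := ler_norm Y; lra.
apply/eqP; rewrite eq_le !leNgt; apply/andP; split; apply/negP => h.
  by apply: (key 1); rewrite ?mulr1 ?mul1r.
by apply: (key (-1)); rewrite ?mulrNN ?mulr1 // !mulN1r ltrN2.
Qed.

End Surface.

Theorem theorem1p8 (R : realType) :
  (forall t : R, 0 < t ->
     Num.sqrt (15 - Num.sqrt 33) / (2 * Num.sqrt 2) < t ->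
     locally_poly_convex (surf t) 0)
  /\ locally_poly_convex (surf (1 : R)) 0.
Proof.
split=> [t t0 ht|].
  have t1 : 1 < t by exact: gt1_of_threshold.
  apply: locally_poly_convex_surf; first by rewrite gt_eqF.
  by move=> K r q; exact: hull_cube_graph.
apply: locally_poly_convex_surf; first exact: oner_neq0.
by move=> K r q; exact: hull_real_cube.
Qed.
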